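(* Let $q:[0,\pi]\to\mathbb{R}$ be a potential admitting an absolutely convergent Fourier cosine expansion $$q(x)=\frac{q_0}{2}+\sum_{k=1}^\infty q_k\cos(kx),\qquad q_k=\frac{2}{\pi}\int_0^\pi q(x)\cos(kx)\,dx\quad (k=0,1,2,\dots),$$ and let $\lambda_1<\lambda_2\le\lambda_3\le\cdots$ be the eigenvalues of the Dirichlet problem $-u''+qu=\lambda u$ on $(0,\pi)$, $u(0)=u(\pi)=0$. Then for all $n\ge 1$, $$\sum_{k=1}^{n}\left(\lambda_k-k^2-\frac{q_0}{2}\right)\le-\frac12\sum_{k=1}^{n}q_{2k}.$$ Equality for any $n\ge1$ implies that $q$ is constant. As $n\to\infty$, the right-hand side of this inequality converges to $$\frac{1}{2\pi}\int_0^\pi q(x)\,dx-\frac{q(0)+q(\pi)}{4}.$$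
   Context: The eigenvalue problem is understood in the usual weak sense (form domain $H^1_0(0,\pi)$). Eigenvalues are listed in increasing order and repeated according to multiplicity. Note that $q_0/2=\frac1\pi\int_0^\pi q(x)\,dx$. *)

(* Defs.v *)
From HB Require Import structures.
From mathcomp Require Import all_boot all_order all_algebra.
From mathcomp Require Import all_classical all_reals all_analysis.

Set Implicit Arguments.
Unset Strict Implicit.
Unset Printing Implicit Defensive.

Import Order.TTheory GRing.Theory Num.Theory.
Import numFieldNormedType.Exports.

Local Open Scope classical_set_scope.
Local Open Scope ring_scope.
Local Open Scope card_scope.

Definition Ipi (R : realType) : set R := `]0, pi[.

Arguments Ipi : clear implicits.

Definition fourier_cos (R : realType) (q : R -> R) (k : nat) : R :=
  2 / pi *
    (\int[@lebesgue_measure R]_(x in `[0, pi]) (q x * cos (k%:R * x)))%R.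

(* The functions q, u, v below are total on R, but only their restriction to
   [0, pi] (resp. their almost-everywhere class on ]0, pi[) matters. *)
Definition abs_cvg_cosine_expansion (R : realType) (q : R -> R) : Prop :=
  cvgn (fun n => \sum_(1 <= k < n.+1) `|fourier_cos q k|) /\
  forall x : R, x \in `[0, pi] ->
    (fun n => fourier_cos q 0 / 2 +
       \sum_(1 <= k < n.+1) fourier_cos q k * cos (k%:R * x)) @ \oo --> q x.

(* C_c^oo(0, pi), each function being extended by zero to the real line *)
Definition test_function (R : realType) (phi : R -> R) : Prop :=
  (forall (n : nat) (x : R), derivable (derive1n n phi) x 1) /\
  exists K : set R,
    [/\ compact K, K `<=` Ipi R & forall x, ~ K x -> phi x = 0].

Definition L2 (R : realType) (u : R -> R) : Prop :=
  measurable_fun (Ipi R) u /\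
  (\int[@lebesgue_measure R]_(x in Ipi R) ((u x) ^+ 2)%:E < +oo)%E.

(* [weak_derivative u du] : du is the distributional derivative of u. *)
Definition weak_derivative (R : realType) (u du : R -> R) : Prop :=
  forall phi : R -> R, test_function phi ->
    (\int[@lebesgue_measure R]_(x in Ipi R) (u x * derive1 phi x))%R =
    - (\int[@lebesgue_measure R]_(x in Ipi R) (du x * phi x))%R.

(* [H10 u du] : u belongs to H^1_0(0, pi), the closure of C_c^oo(0, pi) in
   H^1(0, pi), and du is its weak derivative. *)
Definition H10 (R : realType) (u du : R -> R) : Prop :=
  [/\ L2 u, L2 du, weak_derivative u du &
    exists phi : nat -> R -> R,
      (forall n, test_function (phi n)) /\
      (fun n => \int[@lebesgue_measure R]_(x in Ipi R)
         ((phi n x - u x) ^+ 2 + (derive1 (phi n) x - du x) ^+ 2)%:E)%E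
        @ \oo --> 0%E].

(* Weak solutions u in H^1_0(0, pi) of -u'' + q u = mu u, including u = 0. *)
Definition dirichlet_eigenspace (R : realType) (q : R -> R) (mu : R) :
    set (R -> R) :=
  [set u | exists2 du, H10 u du &
    forall v dv, H10 v dv ->
      (\int[@lebesgue_measure R]_(x in Ipi R)
         (du x * dv x + q x * u x * v x))%R =
      mu * (\int[@lebesgue_measure R]_(x in Ipi R) (u x * v x))%R].

(* [L2_dimension E m] : modulo equality almost everywhere on ]0, pi[, the
   space E has a basis of m elements. *)
Definition L2_dimension (R : realType) (E : set (R -> R)) (m : nat) : Prop :=
  exists f : 'I_m -> R -> R,
    [/\ forall i, E (f i),
        forall c : 'I_m -> R,
          (fun x => \sum_(i < m) c i * f i x) = cst 0
            %[ae @lebesgue_measure R in Ipi R] ->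
          forall i, c i = 0 &
        forall u, E u -> exists c : 'I_m -> R,
          u = (fun x => \sum_(i < m) c i * f i x)
            %[ae @lebesgue_measure R in Ipi R]].

(* lam 1 <= lam 2 <= ... lists the Dirichlet eigenvalues, each mu occurring
   exactly dim(eigenspace of mu) times; in particular (m = 0) a number is
   listed iff it is an eigenvalue. The value lam 0 is irrelevant. *)
Definition dirichlet_eigenvalues (R : realType) (q : R -> R)
    (lam : nat -> R) : Prop :=
  (forall k : nat, (1 <= k)%N -> lam k <= lam k.+1) /\
  (forall (mu : R) (m : nat),
     L2_dimension (dirichlet_eigenspace q mu) m <->
     [set k : nat | (1 <= k)%N /\ lam k = mu] #= `I_m).

(* Main.v *)
Require Import Defs.
From mathcomp Require Import all_boot all_order all_algebra.
From mathcomp Require Import all_classical all_reals all_analysis.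
From mathcomp Require Import measurable_realfun ring lra.


(** The inequality is a trace inequality.  The functions
    sqrt (2 / pi) * sin (k x), 1 <= k <= n, are orthonormal, vanish at both ends
    and have energies k ^ 2 + q_0 / 2 - q_(2k) / 2 for the quadratic form
    \int (u' ^ 2 + q u ^ 2) of the problem, whereas the sum of the n lowest
    eigenvalues is at most the sum of the energies of any n orthonormal functions
    ([trace_ge], [sum_eigenvalues_le]).

    The spectral theory behind this is obtained from Sturm's theory in Pruefer's
    form.  Since its cosine series converges absolutely, q is continuous.  The
    angle of the solution of - u'' + q u = mu u, u 0 = 0, solves a scalar
    differential equation ([picard], [pruefer]) and its value at pi depends
    continuously on mu, so that the intermediate value theorem provides energies
    mu_1 < ... < mu_(n+1) at which this value is pi, ..., (n+1) pi; at these, u is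
    an eigenfunction ([eigenfunction_exists]).  The angle at Gam = mu_(n+1) is a
    multiple of pi at no more than n interior points.  On functions vanishing at
    these points, completing the square with the logarithmic derivative of u shows
    that the energy is at least Gam times the square norm ([jacobi_energy]).  An
    arbitrary f is brought to this case by subtracting a combination of
    u_1, ..., u_n with the same values at the n points, whence
      energy f >= Gam |f| ^ 2 - \sum_j (Gam - mu_j) <f, u_j> ^ 2
    ([energy_ge]); summing over an orthonormal family and using Bessel's
    inequality gives \sum_j mu_j <= \sum_k energy f_k.

    The given list lam enters through the fact that each mu_k occurs in it:
    the eigenspace of mu_k contains a nonzero function, so it has not dimension 0
    ([eigenvalue_listed]).  As lam is nondecreasing and the mu_k are distinct,
    lam k <= mu_k.  That a classical eigenfunction is a weak one requires test
    functions to be dense in the Dirichlet C^1 functions for the H^1 norm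
    ([test_function_approx]).

    In case of equality the first n sines minimise the trace.  Rotating the n-th
    towards the (n + d)-th must not lower it, so the matrix element
    (q_d - q_(d+2n)) / 2 of q between the two vanishes; as q_k tends to 0 this
    forces q_d = 0 for all d >= 1.  The limit of the right-hand side comes from
    q 0 + q pi = q_0 + 2 \sum_k q_(2k). *)

Set Implicit Arguments.
Unset Strict Implicit.
Unset Printing Implicit Defensive.

Import Order.TTheory GRing.Theory Num.Theory.
Import numFieldNormedType.Exports.

Local Open Scope classical_set_scope.
Local Open Scope ring_scope.

(** * Derivatives, continuity and primitives *)

Section Calculus.
Variable R : realType.
Implicit Types (f g F G : R -> R) (x y a b c : R).

(** The rules of derivation are put in pointwise form, the derivative being an
    argument of the hypotheses, so that they apply to explicit formulas. *)
Lemma derivD f g x a b : is_derive x 1 f a -> is_derive x 1 g b ->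
  is_derive x 1 (fun t => f t + g t) (a + b).
Proof. exact: is_deriveD. Qed.

Lemma derivB f g x a b : is_derive x 1 f a -> is_derive x 1 g b ->
  is_derive x 1 (fun t => f t - g t) (a - b).
Proof. exact: is_deriveB. Qed.

Lemma derivN f x a : is_derive x 1 f a -> is_derive x 1 (fun t => - f t) (- a).
Proof. exact: is_deriveN. Qed.

Lemma derivM f g x a b : is_derive x 1 f a -> is_derive x 1 g b ->
  is_derive x 1 (fun t => f t * g t) (a * g x + f x * b).
Proof.
move=> fa gb; apply: (is_derive_eq (is_deriveM fa gb)).
by rewrite /GRing.scale/= addrC [g x * a]mulrC.
Qed.

Lemma derivC c x : is_derive x 1 (fun=> c) 0.
Proof. exact: is_derive_cst. Qed.

Lemma derivZ c f x a : is_derive x 1 f a ->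
  is_derive x 1 (fun t => c * f t) (c * a).
Proof.
move=> fa; apply: (is_derive_eq (derivM (@derivC c x) fa)).
by rewrite mul0r add0r.
Qed.

Lemma deriv_id x : is_derive x 1 (fun t : R => t) 1.
Proof. exact: is_derive_id. Qed.

Lemma derivV f x a : f x != 0 -> is_derive x 1 f a ->
  is_derive x 1 (fun t => (f t)^-1) (- a / (f x) ^+ 2).
Proof.
move=> fx0 fa; have h := is_deriveV fx0 fa.
apply: (is_derive_eq h); rewrite /GRing.scale/=; field; exact: fx0.
Qed.

Lemma deriv_comp f g x a b : is_derive x 1 f a -> is_derive (f x) 1 g b ->
  is_derive x 1 (fun t => g (f t)) (b * a).
Proof. by move=> fa gb; exact: (@is_derive1_comp _ g f x b a). Qed.

Lemma deriv_sum n (f : 'I_n -> R -> R) (df : 'I_n -> R) x :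
  (forall i, is_derive x 1 (f i) (df i)) ->
  is_derive x 1 (fun t => \sum_i f i t) (\sum_i df i).
Proof.
move=> fd; have -> : (fun t => \sum_i f i t) = \sum_i f i.
  by apply/funext => t; rewrite fct_sumE.
exact: is_derive_sum.
Qed.

Lemma deriv_cont f x a : is_derive x 1 f a -> {for x, continuous f}.
Proof.
by move=> fa; apply/differentiable_continuous/derivable1_diffP/ex_derive.
Qed.

Lemma deriv_uniq f x a b : is_derive x 1 f a -> is_derive x 1 f b -> a = b.
Proof. by move=> [_ <-] [_ <-]. Qed.

Lemma contD f g : continuous f -> continuous g ->
  continuous (fun x => f x + g x).
Proof. by move=> cf cg x; apply: cvgD; [exact: cf|exact: cg]. Qed.

Lemma contN f : continuous f -> continuous (fun x => - f x).
Proof. by move=> cf x; apply: cvgN; exact: cf. Qed.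

Lemma contB f g : continuous f -> continuous g ->
  continuous (fun x => f x - g x).
Proof. by move=> cf cg; apply: contD => //; exact: contN. Qed.

Lemma contM f g : continuous f -> continuous g ->
  continuous (fun x => f x * g x).
Proof. by move=> cf cg x; apply: cvgM; [exact: cf|exact: cg]. Qed.

Lemma contC c : continuous (fun _ : R => c).
Proof. by move=> x; exact: cvg_cst. Qed.

Lemma cont_id : continuous (fun x : R => x).
Proof. by move=> x; exact: cvg_id. Qed.

Lemma contX f n : continuous f -> continuous (fun x => f x ^+ n).
Proof.
move=> cf; elim: n => [|n IH]; first by under eq_fun do rewrite expr0; exact: contC.
have -> : (fun x => f x ^+ n.+1) = (fun x => f x * f x ^+ n).
  by apply/funext => x; rewrite exprS.
exact: contM.
Qed.

Lemma cont_comp f g : continuous f -> continuous g ->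
  continuous (fun x => g (f x)).
Proof. by move=> cf cg x; apply: continuous_comp; [exact: cf|exact: cg]. Qed.

Lemma cont_sum n (f : 'I_n -> R -> R) : (forall i, continuous (f i)) ->
  continuous (fun t => \sum_i f i t).
Proof.
move=> cf; have -> : (fun t => \sum_i f i t) = \sum_i f i.
  by apply/funext => t; rewrite fct_sumE.
elim/big_ind: _ => //; [exact: contC|exact: contD].
Qed.

Lemma deriv_continuous f df : (forall x, is_derive x 1 f (df x)) ->
  continuous f.
Proof. by move=> h x; exact: deriv_cont (h x). Qed.

Lemma mean_value f df a b : a <= b ->
  (forall x, a <= x <= b -> is_derive x 1 f (df x)) ->
  exists2 c, a <= c <= b & f b - f a = df c * (b - a).
Proof.
move=> ab h.
have [||c] := @MVT_segment R f df a b ab.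
- by move=> x; rewrite in_itv/= => /andP[ax xb]; apply: h; rewrite !ltW.
- apply: derivable_within_continuous => x; rewrite in_itv/= => /h fd.
  exact: ex_derive.
- by rewrite in_itv/= => ?; exists c.
Qed.

Lemma deriv_ge0_le f df a b : a <= b ->
  (forall x, a <= x <= b -> is_derive x 1 f (df x)) ->
  (forall x, a <= x <= b -> 0 <= df x) -> f a <= f b.
Proof.
move=> ab h dge0; have [c cab e] := mean_value ab h.
by rewrite -subr_ge0 e mulr_ge0 ?subr_ge0// dge0.
Qed.

Lemma deriv_0_const f a b : a <= b ->
  (forall x, a <= x <= b -> is_derive x 1 f 0) -> f a = f b.
Proof.
move=> ab h; have [c cab e] := @mean_value f (fun=> 0) a b ab h.
by apply/eqP; rewrite eq_sym -subr_eq0 e mul0r.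
Qed.

Lemma cont_integrable f a b : continuous f ->
  (@lebesgue_measure R).-integrable `[a, b] (EFin \o f).
Proof.
move=> cf; apply: continuous_compact_integrable; first exact: segment_compact.
exact: continuous_subspaceT.
Qed.

Lemma primitive_after f a : continuous f ->
  exists F, forall x, a < x -> is_derive x 1 F (f x).
Proof.
move=> cf; exists (fun x => \int[@lebesgue_measure R]_(t in `[a, x]) f t) => x ax.
have xx1 : x < x + 1 by rewrite ltrDl.
have [] := continuous_FTC1_closed xx1 (cont_integrable a (x + 1) cf) ax (cf x).
by move=> d e; apply: DeriveDef; [|rewrite -derive1E].
Qed.

(** The primitives on the half-lines x > - n, normalised to vanish at 0, agree
    with each other by the mean value theorem; near x one of them is used. *)
Lemma primitive f : continuous f ->
  exists F, F 0 = 0 /\ forall x, is_derive x 1 F (f x).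
Proof.
move=> cf.
have /choice[G Gd] : forall n : nat, exists G, forall x, - n.+1%:R < x ->
    is_derive x 1 G (f x) by move=> n; exact: primitive_after.
pose H n x := G n x - G n 0.
have Hd n x : - n.+1%:R < x -> is_derive x 1 (H n) (f x).
  move=> nx; apply: is_derive_eq (derivB (Gd n x nx) (derivC _ x)) _.
  by rewrite subr0.
have HE n m x : (n <= m)%N -> - n.+1%:R < x -> H n x = H m x.
  move=> nm nx; apply/eqP; rewrite -subr_eq0; apply/eqP.
  have nm' : - m.+1%:R <= - n.+1%:R :> R by rewrite lerN2 ler_nat.
  have d0 y : Num.min 0 x <= y -> is_derive y 1 (fun t => H n t - H m t) 0.
    move=> xy; have ny : - n.+1%:R < y.
      by apply: lt_le_trans xy; rewrite lt_min nx oppr_lt0 ltr0n.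
    apply: is_derive_eq (derivB (Hd n y ny) (Hd m y (le_lt_trans nm' ny))) _.
    by rewrite subrr.
  have e0 : H n 0 - H m 0 = 0 by rewrite /H !subrr.
  have [x0|x0] := leP 0 x.
    rewrite -e0; symmetry; apply: (@deriv_0_const (fun t => H n t - H m t)) => //.
    by move=> y /andP[y0 _]; apply: d0; rewrite (min_idPl x0).
  rewrite -e0; apply: (@deriv_0_const (fun t => H n t - H m t)); first exact: ltW.
  by move=> y /andP[y0 _]; apply: d0; rewrite (min_idPr (ltW x0)).
pose N x := Num.truncn `|x|.
exists (fun x => H (N x) x); split; first by rewrite /H subrr.
move=> x; have lN y : `|y| < (N y).+1%:R by exact: truncnS_gt.
have Nx : - (N x).+1%:R < x.
  have /ltr_normlP[h _] := lN x; by rewrite ltrNl.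
apply: (near_eq_is_derive _ (Hd (N x).+1 x _)) => //; last first.
  by apply: le_lt_trans Nx; rewrite lerN2 ler_nat.
near=> y; have yN : - (N x).+1%:R < y.
  by near: y; exact: lt_nbhsr.
have yNy : - (N y).+1%:R < y by have /ltr_normlP[h _] := lN y; rewrite ltrNl.
have [le|/ltnW le] := leqP (N y) (N x).+1; first by rewrite (HE _ _ _ le).
rewrite (HE _ _ _ le)//; apply: le_lt_trans yN; by rewrite lerN2 ler_nat.
Unshelve. all: by end_near. Qed.

End Calculus.

(** * Integrals over the segment, comparison, uniform limits *)

Section IntegralOnSegment.
Variable R : realType.
Implicit Types (f g F : R -> R) (c : R).

Definition integ f : R := \int[@lebesgue_measure R]_(x in `[0, pi]) f x.

Lemma integ_ext f g : (forall x, 0 <= x <= pi -> f x = g x) ->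
  integ f = integ g.
Proof.
by move=> fg; apply: eq_Rintegral => x; rewrite inE/= in_itv/= => /fg.
Qed.

Lemma integD f g : continuous f -> continuous g ->
  integ (fun x => f x + g x) = integ f + integ g.
Proof.
by move=> cf cg; apply: RintegralD => //; exact: cont_integrable.
Qed.

Lemma integZ c f : continuous f -> integ (fun x => c * f x) = c * integ f.
Proof. by move=> cf; apply: RintegralZl => //; exact: cont_integrable. Qed.

Lemma integN f : continuous f -> integ (fun x => - f x) = - integ f.
Proof.
move=> cf; rewrite -[RHS]mulN1r -integZ//; apply: integ_ext => x _.
by rewrite mulN1r.
Qed.

Lemma integB f g : continuous f -> continuous g ->
  integ (fun x => f x - g x) = integ f - integ g.
Proof. by move=> cf cg; rewrite integD ?integN//; exact: contN. Qed.

Lemma integ0 : integ (fun=> 0) = 0.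
Proof. by rewrite /integ Rintegral_cst// mul0r. Qed.

Lemma integ_sum n (f : 'I_n -> R -> R) : (forall i, continuous (f i)) ->
  integ (fun x => \sum_i f i x) = \sum_i integ (f i).
Proof.
elim: n f => [|n IH] f cf.
  by rewrite big_ord0 -[RHS]integ0; apply: integ_ext => x _; rewrite big_ord0.
rewrite big_ord_recr/= -IH// -integD//; last exact: cont_sum.
by apply: integ_ext => x _; rewrite big_ord_recr.
Qed.

Lemma integ_deriv F f : continuous f ->
  (forall x, 0 <= x <= pi -> is_derive x 1 F (f x)) -> integ f = F pi - F 0.
Proof.
move=> cf Fd; rewrite /integ /Rintegral (@continuous_FTC2 _ f F) //.
- exact: pi_gt0.
- exact: continuous_subspaceT.
- have cF x : 0 <= x <= pi -> {for x, continuous F}.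
    by move=> /Fd; exact: deriv_cont.
  split.
  + move=> x; rewrite in_itv/= => /andP[x0 xpi]; apply: ex_derive.
    by apply: Fd; rewrite !ltW.
  + by apply: cvg_at_right_filter; apply: cF; rewrite lexx pi_ge0.
  + by apply: cvg_at_left_filter; apply: cF; rewrite lexx pi_ge0.
- move=> x; rewrite in_itv/= => /andP[x0 xpi]; rewrite derive1E.
  have h : 0 <= x <= pi by rewrite !ltW.
  by have [_ ->] := Fd x h.
Qed.

Lemma integ_ge0 f : continuous f -> (forall x, 0 <= x <= pi -> 0 <= f x) ->
  0 <= integ f.
Proof.
by move=> _ f0; apply: Rintegral_ge0 => x /=; rewrite in_itv/=; exact: f0.
Qed.

Lemma le_integ f g : continuous f -> continuous g ->
  (forall x, 0 <= x <= pi -> f x <= g x) -> integ f <= integ g.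
Proof.
move=> cf cg fg; by apply: le_Rintegral => //; exact: cont_integrable.
Qed.

End IntegralOnSegment.

Section Comparison.
Variable R : realType.
Implicit Types (w dw : R -> R) (a b x L : R).

(** Where w is positive, w * exp (- L x) does not increase; started from the last
    point s at which w <= 0, it cannot become positive. *)
Lemma comparison w dw a b L :
  (forall x, a <= x <= b -> is_derive x 1 w (dw x)) -> w a <= 0 ->
  (forall x, a <= x <= b -> 0 < w x -> dw x <= L * w x) ->
  forall x, a <= x <= b -> w x <= 0.
Proof.
move=> wd wa dwL x /andP[ax xb]; rewrite leNgt; apply/negP => wx0.
pose S := [set t | a <= t <= x /\ w t <= 0].
have Sa : S a by split; rewrite ?lexx.
have hS : has_sup S by split; [exists a|exists x => t [/andP[]]].
set s := sup S.
have as_ : a <= s by apply: ub_le_sup => //; case: hS.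
have sx : s <= x by apply: ge_sup; [exists a|move=> t [/andP[]]].
have sd t : a <= t <= x -> is_derive t 1 w (dw t).
  by move=> /andP[at_ tx]; apply: wd; rewrite at_ (le_trans tx).
have ws : w s <= 0.
  rewrite leNgt; apply/negP => ws0.
  have /nbhs_ballP[e/= e0 he] : \forall t \near s, 0 < w t.
    have cs : {for s, continuous w} by apply/deriv_cont/sd/andP.
    by have /cvgr_gt/(_ 0 ws0) := cs.
  have [t [tx wt] ts] := sup_adherent e0 hS.
  have tls : t <= s by apply: ub_le_sup => //; case: hS.
  have := he t; rewrite /ball/= ger0_norm ?subr_ge0//.
  move=> /(_ _)/lt_geF; rewrite wt => h; suff : false by [].
  by rewrite -h// ltrBlDr addrC -ltrBlDr.
have sx' : s < x.
  by rewrite lt_neqAle sx andbT; apply: contraTneq wx0 => <-; rewrite -leNgt.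
have wpos t : s < t <= x -> 0 < w t.
  move=> /andP[st tx]; rewrite ltNge; apply/negP => wt.
  have : t <= s.
    apply: ub_le_sup; first by case: hS.
    by split=> //; rewrite tx (le_trans as_ (ltW st)).
  by rewrite leNgt st.
pose W t := w t * expR (- (L * t)).
pose dW t := (dw t - L * w t) * expR (- (L * t)).
have Wd t : a <= t <= x -> is_derive t 1 W (dW t).
  move=> tI; have e1 := deriv_comp (derivN (derivZ L (deriv_id t))) (is_derive_expR _).
  apply: is_derive_eq (derivM (sd t tI) e1) _.
  by rewrite /dW; ring.
have [||c cI e] := @MVT R W dW s x sx'.
- move=> t; rewrite in_itv/= => /andP[st tx]; apply: Wd.
  by rewrite (ltW tx) (le_trans as_ (ltW st)).
- apply: derivable_within_continuous => t; rewrite in_itv/= => /andP[st tx].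
  by apply: ex_derive; apply: Wd; rewrite (le_trans as_ st).
move: cI; rewrite in_itv/= => /andP[sc cx].
have dWc : dW c <= 0.
  have cI : a <= c <= b.
    by rewrite (le_trans as_ (ltW sc)) (le_trans (ltW cx)).
  rewrite /dW mulr_le0_ge0 ?expR_ge0// subr_le0 dwL// wpos// sc ltW//.
have Wx : 0 < W x by rewrite mulr_gt0// expR_gt0.
have Ws : W s <= 0 by rewrite mulr_le0_ge0// expR_ge0.
have : W x - W s <= 0 by rewrite e mulr_le0_ge0// subr_ge0.
by rewrite subr_le0 => /(lt_le_trans Wx); rewrite ltNge Ws.
Qed.

End Comparison.

Section UniformLimit.
Variable R : realType.

Lemma uniform_limit (Y : nat -> R -> R) (e : nat -> R) :
  (forall eps, 0 < eps -> exists n, e n < eps) ->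
  (forall n m x, (n <= m)%N -> `|Y m x - Y n x| <= e n) ->
  exists phi : R -> R,
    [/\ forall n x, `|phi x - Y n x| <= e n,
        forall x, Y ^~ x @ \oo --> phi x &
        (forall n, continuous (Y n)) -> continuous phi].
Proof.
move=> e0 Ye.
have cY x : cvg (Y ^~ x @ \oo).
  apply/cauchy_cvgP/cauchy_exP => eps eps0; have [n en] := e0 _ eps0.
  exists (Y n x); exists n => // m/= nm; rewrite /ball/= distrC.
  exact: le_lt_trans (Ye _ _ _ nm) en.
pose phi x := lim (Y ^~ x @ \oo).
have pY n x : `|phi x - Y n x| <= e n.
  have h : (fun m => `|Y m x - Y n x|) @ \oo --> `|phi x - Y n x|.
    by apply: cvg_norm; apply: cvgB; [exact: cY|exact: cvg_cst].
  by apply: (cvgr_to_le h); exists n => // m/= nm; exact: Ye.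
exists phi; split=> // contY x; apply/cvgrPdist_lt => eps eps0.
have [|n en] := e0 (eps / 3); first by rewrite divr_gt0.
have /cvgrPdist_lt/(_ (eps / 3)) := contY n x.
rewrite divr_gt0// => /(_ isT); apply: filterS => t ht.
have := pY n x; have := pY n t.
move: ht en; rewrite !ltr_norml !ler_norml; lra.
Qed.

Lemma geometric_small (B eps : R) : 0 < eps -> exists n, B / 2 ^+ n < eps.
Proof.
move=> eps0; exists (Num.truncn `|B / eps|).
set n := Num.truncn _.
have h1 : `|B / eps| < n.+1%:R by exact: truncnS_gt.
have h2 : n.+1%:R <= 2 ^+ n :> R by rewrite -natrX ler_nat ltn_expl.
rewrite ltr_pdivrMr ?exprn_gt0// mulrC -ltr_pdivrMr//.
by apply: le_lt_trans (ler_norm _) (lt_le_trans h1 h2).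
Qed.

End UniformLimit.

(** * A scalar ordinary differential equation *)

Section ScalarODE.
Variable R : realType.
Implicit Types (x t L b : R).

(** Both d and - d are compared with the solution k of k' = L k + eps, k 0 = 0. *)
Lemma gronwall (d dd : R -> R) b L eps : 0 < L -> 0 <= b -> d 0 = 0 ->
  (forall x, 0 <= x <= b -> is_derive x 1 d (dd x)) ->
  (forall x, 0 <= x <= b -> `|dd x| <= L * `|d x| + eps) ->
  forall x, 0 <= x <= b -> `|d x| <= eps * ((expR (L * x) - 1) / L).
Proof.
move=> L0 b0 d0 dD ddL.
have eps0 : 0 <= eps.
  have := ddL 0; rewrite lexx b0 d0 normr0 mulr0 add0r => /(_ isT).
  exact: le_trans.
pose k x := eps * ((expR (L * x) - 1) / L).
have kd x : is_derive x 1 k (eps * expR (L * x)).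
  have e1 := deriv_comp (derivZ L (deriv_id x)) (is_derive_expR _).
  have e2 := derivZ (eps / L) (derivB e1 (derivC 1 x)).
  have -> : k = fun x => eps / L * (expR (L * x) - 1).
    by apply/funext => y; rewrite /k; ring.
  apply: is_derive_eq e2 _.
  by rewrite subr0 mulr1 mulrA mulrAC divfK ?gt_eqF// mulrC.
have k0 : k 0 = 0 by rewrite /k mulr0 expR0 subrr mul0r mulr0.
have kge0 x : 0 <= x -> 0 <= k x.
  move=> x0; rewrite /k mulr_ge0// divr_ge0 ?(ltW L0)// subr_ge0 -expR0 ler_expR.
  by rewrite mulr_ge0// ltW.
have Lk x : L * k x = eps * expR (L * x) - eps.
  by rewrite /k; field; rewrite gt_eqF.
have main (s : R) : `|s| = 1 -> forall x, 0 <= x <= b -> s * d x - k x <= 0.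
  move=> s1; apply: (@comparison _ _ (fun x => s * dd x - eps * expR (L * x)) 0 b L).
  - by move=> x xb; apply: derivB (kd x); exact: derivZ (dD x xb).
  - by rewrite d0 mulr0 k0 subrr.
  - move=> x xb h; have kx : 0 <= k x by apply: kge0; case/andP: xb.
    have sd0 : 0 <= s * d x by rewrite ltW// (le_lt_trans kx)// -subr_gt0.
    have e : `|d x| = s * d x.
      by rewrite -[RHS]ger0_norm// normrM s1 mul1r.
    have := ddL x xb; rewrite e => h2.
    have h3 : s * dd x <= `|dd x| by rewrite -[leRHS]mul1r -s1 -normrM ler_norm.
    by rewrite mulrBr Lk; lra.
move=> x xb; have := main 1; rewrite normr1 => /(_ erefl x xb).
have := main (-1); rewrite normrN normr1 => /(_ erefl x xb).
rewrite -/(k x) ler_norml; lra.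
Qed.

(** Picard iteration.  Halving of successive differences is obtained in the
    weighted norm sup |y x| exp (- 2 L x), so that a single run covers the whole
    interval. *)
Lemma picard (F : R -> R -> R) L b : 0 < L -> 0 <= b ->
  (forall y : R -> R, continuous y -> continuous (fun t => F t (y t))) ->
  (forall t y z, 0 <= t <= b -> `|F t y - F t z| <= L * `|y - z|) ->
  exists y : R -> R, [/\ y 0 = 0, continuous y &
    forall x, 0 <= x <= b -> is_derive x 1 y (F x (y x))].
Proof.
move=> L0 b0 cF FL.
have /choice[T HT] : forall y : R -> R, exists z : R -> R, continuous y ->
    z 0 = 0 /\ forall x, is_derive x 1 z (F x (y x)).
  move=> y; have [cy|ncy] := pselect (continuous y).
    by have [z zP] := primitive (cF y cy); exists z.
  by exists y.
pose Y n := iter n T (fun=> 0).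
have cY n : continuous (Y n).
  elim: n => [|n IH]; first exact: contC.
  by have [_ h] := HT _ IH; exact: deriv_continuous h.
have Y0 n : Y n 0 = 0 by case: n => [//|n]; have [] := HT _ (cY n).
have YS n x : is_derive x 1 (Y n.+1) (F x (Y n x)).
  by have [_] := HT _ (cY n); exact.
have [A A0 hA] : exists2 A, 0 <= A & forall x, 0 <= x <= b -> `|Y 1 x| <= A.
  have cn : continuous (fun x => `|Y 1%N x|).
    by move=> x; apply: cvg_norm; exact: cY.
  have [c _ hc] := EVT_max b0 (continuous_subspaceT cn).
  by exists `|Y 1%N c| => // x; have := hc x; rewrite in_itv.
pose E x := expR (2 * L * x).
have Ed x : is_derive x 1 E (2 * L * E x).
  have h := deriv_comp (derivZ (2 * L) (deriv_id x)) (is_derive_expR _).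
  by apply: is_derive_eq h _; rewrite mulr1 mulrC.
have E1 x : 0 <= x -> 1 <= E x.
  move=> x0; rewrite /E -[leLHS]expR0 ler_expR mulr_ge0// mulr_ge0// ltW//.
have step n x : 0 <= x <= b -> `|Y n.+1 x - Y n x| <= A / 2 ^+ n * E x.
  elim: n x => [|n IH] x xb.
    rewrite expr0 divr1 /Y/= subr0 (le_trans (hA x xb))// ler_peMr// E1//.
    by case/andP: xb.
  have x0 : 0 <= x by case/andP: xb.
  set B := A / 2 ^+ n.+1.
  have B0 : 0 <= B by rewrite divr_ge0// exprn_ge0.
  have eB : A / 2 ^+ n = 2 * B by rewrite /B exprS; field; rewrite expf_neq0.
  pose D t := F t (Y n.+1 t) - F t (Y n t).
  have Dle t : 0 <= t <= b -> `|D t| <= B * (2 * L * E t).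
    move=> tb; apply: le_trans (FL _ _ _ tb) _.
    have := IH t tb; rewrite eB => h.
    have := ler_wpM2l (ltW L0) h; lra.
  have main (s : R) : `|s| = 1 -> s * (Y n.+2 x - Y n.+1 x) <= B * E x.
    move=> s1.
    have : B * E 0 - s * (Y n.+2 0 - Y n.+1 0) <=
           B * E x - s * (Y n.+2 x - Y n.+1 x).
      pose dh t := B * (2 * L * E t) - s * D t.
      apply: (@deriv_ge0_le _ (fun t => B * E t - s * (Y n.+2 t - Y n.+1 t)) dh);
        first exact: x0.
      move=> t /andP[t0 tx]; have tb : 0 <= t <= b.
        by rewrite t0 (le_trans tx)//; case/andP: xb.
      rewrite subr_ge0; apply: le_trans (Dle t tb).
      by rewrite -[leRHS]mul1r -s1 -normrM ler_norm.
    rewrite !Y0 subrr mulr0 subr0 => h; rewrite -subr_ge0; apply: le_trans h.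
    by rewrite mulr_ge0// expR_ge0.
  have := main 1; rewrite normr1 => /(_ erefl).
  have := main (-1); rewrite normrN normr1 => /(_ erefl).
  rewrite ler_norml; lra.
pose B := A * E b.
have stepB n x : 0 <= x <= b -> `|Y n.+1 x - Y n x| <= B / 2 ^+ n.
  move=> xb; apply: le_trans (step n x xb) _.
  rewrite /B [leRHS]mulrAC ler_wpM2l//; first by rewrite divr_ge0// exprn_ge0.
  rewrite /E ler_expR ler_wpM2l//; last by case/andP: xb.
  by rewrite mulr_ge0// ltW.
pose cl x := Num.min (Num.max x 0) b.
have clb x : 0 <= cl x <= b.
  by rewrite /cl le_min ge_min lexx b0 !orbT le_max lexx orbT.
have clE x : 0 <= x <= b -> cl x = x.
  by move=> /andP[x0 xb]; rewrite /cl (max_idPl x0) (min_idPl xb).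
have ccl : continuous cl.
  move=> x; apply: (@continuous_min R R (fun y => Num.max y 0) (fun=> b)).
    by apply: (@continuous_max R R (fun y => y) (fun=> 0));
      [exact: cvg_id|exact: cvg_cst].
  exact: cvg_cst.
have B0 : 0 <= B by rewrite mulr_ge0// expR_ge0.
have p0 n : 0 <= 2 * B / 2 ^+ n.
  by apply: divr_ge0; [exact: mulr_ge0|exact: exprn_ge0].
have far n m x : (n <= m)%N -> `|Y m (cl x) - Y n (cl x)| <= 2 * B / 2 ^+ n.
  move=> /subnK <-; move: (m - n)%N => k; elim: k n => [|k IH] n.
    by rewrite add0n subrr normr0.
  rewrite addSnnS.
  have h2 := stepB n _ (clb x).
  have -> : Y (k + n.+1)%N (cl x) - Y n (cl x) =
    (Y (k + n.+1)%N (cl x) - Y n.+1 (cl x)) + (Y n.+1 (cl x) - Y n (cl x)) by ring.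
  apply: le_trans (ler_normD _ _) _; apply: le_trans (lerD (IH n.+1) h2) _.
  by rewrite exprS le_eqVlt; apply/orP; left; apply/eqP; field; rewrite expf_neq0.
have [phi [phiY _ cphi]] := @uniform_limit R (fun n x => Y n (cl x)) _
  (geometric_small (2 * B)) far.
have {}cphi : continuous phi by apply: cphi => n; exact: cont_comp.
have [y [y0 yd]] := primitive (cF _ cphi).
suff yE x : 0 <= x <= b -> y x = phi x.
  exists y; split=> //; first exact: deriv_continuous yd.
  by move=> x xb; rewrite yE.
move=> xb; have x0 : 0 <= x by case/andP: xb.
have yY n : `|y x - Y n.+1 x| <= 2 * B / 2 ^+ n * (L * b).
  have [c /andP[c0 cx]] : exists2 c, 0 <= c <= x &
    (y x - Y n.+1 x) - (y 0 - Y n.+1 0) = (F c (phi c) - F c (Y n c)) * (x - 0).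
    apply: (@mean_value _ (fun t => y t - Y n.+1 t)
      (fun c => F c (phi c) - F c (Y n c))); exact: x0.
  have cb : 0 <= c <= b by rewrite c0 (le_trans cx)//; case/andP: xb.
  rewrite y0 Y0 !subr0 => ->; rewrite normrM (ger0_norm x0).
  have h := FL c (phi c) (Y n c) cb.
  have := phiY n c; rewrite clE// => h2.
  have h3 := le_trans h (ler_wpM2l (ltW L0) h2).
  have xb' : x <= b by case/andP: xb.
  apply: le_trans (ler_pM _ _ h3 xb') _ => //.
  by rewrite le_eqVlt; apply/orP; left; apply/eqP; ring.
apply/eqP; rewrite -subr_eq0 -normr_le0; apply/ler_addgt0Pr => eps eps0.
rewrite add0r.
have [n] := geometric_small (2 * B * (L * b + 1)) eps0.
move=> /ltW; apply: le_trans.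
have -> : y x - phi x = (y x - Y n.+1 x) - (phi x - Y n.+1 x) by ring.
apply: le_trans (ler_normB _ _) _; have h1 := yY n.
have := phiY n.+1 x; rewrite clE// => h2.
apply: le_trans (lerD h1 h2) _.
have -> : 2 * B / 2 ^+ n.+1 = 2 * B / 2 ^+ n / 2.
  by rewrite exprS; field; rewrite expf_neq0.
have -> : 2 * B * (L * b + 1) / 2 ^+ n = 2 * B / 2 ^+ n * (L * b) + 2 * B / 2 ^+ n.
  by ring.
have := p0 n; lra.
Qed.

End ScalarODE.

(** * The Pruefer angle *)

Section Pruefer.
Variable R : realType.
Implicit Types (q psi : R -> R) (m mu x y z : R).

Lemma sin_lipschitz y z : `|sin y - sin z| <= `|y - z| :> R.
Proof.
wlog zy : y z / z <= y => [H|].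
  have [/H//|/ltW/H] := leP z y; by rewrite distrC [X in _ <= X]distrC.
have [c _ e] := @mean_value R sin cos z y zy (fun x _ => is_derive_sin x).
by rewrite e normrM ler_piMl// cos_max.
Qed.

Lemma sin_norm_le y : `|sin y| <= `|y|.
Proof. by have := sin_lipschitz y 0; rewrite sin0 !subr0. Qed.

Lemma sin_sqr_lipschitz y z : `|sin y ^+ 2 - sin z ^+ 2| <= 2 * `|y - z|.
Proof.
rewrite subr_sqr normrM mulrC ler_pM//; last exact: sin_lipschitz.
by apply: le_trans (ler_normD _ _) _; rewrite -[2]/(1 + 1) lerD// sin_max.
Qed.

Lemma sin_sqr_le y : 0 <= y -> sin y ^+ 2 <= y.
Proof.
move=> y0; rewrite -real_normK ?num_real// expr2.
have h1 := sin_max y; have h2 := sin_norm_le y; rewrite (ger0_norm y0) in h2.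
by apply: le_trans h2; rewrite ler_piMr.
Qed.

Lemma sin_sqrBnatpi n y : sin (n%:R * pi - y) ^+ 2 = sin y ^+ 2.
Proof.
rewrite -sqrrN -sinN opprB mulr_natl.
have -> : sin y = sin (y - pi *+ n + pi *+ n) by rewrite subrK.
rewrite (alternatingn (@sinDpi R)) exprMn -exprM mulnC exprM.
by rewrite sqrrN expr1n expr1n mul1r.
Qed.

Lemma sin_natpi n : sin (n%:R * pi) = 0 :> R.
Proof.
by apply/eqP; rewrite -(sqrf_eq0 (sin _)) -[_ * _]subr0 sin_sqrBnatpi sin0 expr0n.
Qed.

Lemma sin_eq0_natpi y n : 0 < y < n.+1%:R * pi -> sin y = 0 ->
  exists2 j, (0 < j <= n)%N & y = j%:R * pi.
Proof.
move=> /andP[y0 yn] sy; pose j := Num.truncn (y / pi).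
have pi0 := pi_gt0 R.
have ypi : 0 <= y / pi by rewrite divr_ge0 ?ltW.
have /andP[j1 j2] : j%:R <= y / pi < j.+1%:R by exact: truncn_itv.
rewrite ler_pdivlMr// in j1; rewrite ltr_pdivrMr// in j2.
have yj : y = j%:R * pi.
  apply/eqP; rewrite eq_le j1 andbT leNgt; apply/negP => jy.
  have : 0 < sin (y - j%:R * pi).
    apply: sin_gt0_pi; rewrite subr_gt0 jy/= ltrBlDr -[X in X + _]mul1r -mulrDl.
    by rewrite [1 + _]addrC natr1.
  move=> /(exprn_gt0 2); rewrite -sqrrN -sinN opprB sin_sqrBnatpi sy.
  by rewrite expr0n ltxx.
exists j => //; apply/andP; split.
  by move: y0; rewrite yj pmulr_lgt0// ltr0n.
by move: yn; rewrite yj ltr_pM2r// ltr_nat ltnS.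
Qed.

(** The scaled Pruefer angle of the solution u of - u'' + q u = mu u, u 0 = 0:
    tan psi = m u / u'.  Taking the scale m of the size of the square root of mu
    makes the angle grow at speed at least m for large mu. *)
Definition pruefer q m mu psi :=
  [/\ psi 0 = 0, continuous psi & forall x, 0 <= x <= pi ->
      is_derive x 1 psi (m + ((mu - q x) / m - m) * sin (psi x) ^+ 2)].

Section Angle.
Variables (q : R -> R) (M m : R).
Hypotheses (cq : continuous q) (qM : forall x, `|q x| <= M) (m0 : 0 < m).

Let rate mu x := (mu - q x) / m - m.
Let rmax mu := (`|mu| + M) / m + m.

Let M0 : 0 <= M.
Proof. exact: le_trans (normr_ge0 _) (qM 0). Qed.

Let rate_max mu x : `|rate mu x| <= rmax mu.
Proof.
rewrite /rate /rmax (le_trans (ler_normB _ _))// (gtr0_norm m0) lerD2r.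
rewrite normrM normfV (gtr0_norm m0) ler_pM2r ?invr_gt0//.
by rewrite (le_trans (ler_normB _ _))// lerD2l.
Qed.

Let rmax_gt0 mu : 0 < rmax mu.
Proof. by rewrite ltr_wpDl// divr_ge0 ?addr_ge0// ltW. Qed.

Let crate mu : continuous (rate mu).
Proof.
by apply: contB; [apply: contM; [apply: contB|]|]; (exact: contC || exact: cq).
Qed.

Lemma pruefer_exists mu : exists psi, pruefer q m mu psi.
Proof.
pose F x y := m + rate mu x * sin y ^+ 2.
have [|y cy|t y z _|psi [p0 cp pd]] := @picard R F (2 * rmax mu) pi _ (pi_ge0 R).
- by rewrite mulr_gt0.
- apply: contD; first exact: contC.
  apply: contM; first exact: crate.
  by apply: contX; apply: cont_comp cy _; exact: continuous_sin.
- rewrite /F [m + _]addrC addrKA -mulrBr normrM -mulrA mulrCA ler_pM//.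
  exact: sin_sqr_lipschitz.
- by exists psi; split.
Qed.

Lemma pruefer_cont (Psi : R -> R -> R) : (forall mu, pruefer q m mu (Psi mu)) ->
  continuous (fun mu => Psi mu pi).
Proof.
move=> HP mu; set L := 2 * rmax mu.
have L0 : 0 < L by rewrite mulr_gt0.
pose C := (expR (L * pi) - 1) / L / m.
have C0 : 0 <= C.
  rewrite divr_ge0 ?(ltW m0)// divr_ge0 ?(ltW L0)// subr_ge0 -[leLHS]expR0 ler_expR.
  by rewrite mulr_ge0 ?(ltW L0)// pi_ge0.
have key nu : `|Psi mu pi - Psi nu pi| <= `|mu - nu| * C.
  have [p0 cp pd] := HP mu; have [n0 cn nd] := HP nu.
  pose dd x := (m + rate mu x * sin (Psi mu x) ^+ 2) -
               (m + rate nu x * sin (Psi nu x) ^+ 2).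
  have := @gronwall R (fun x => Psi mu x - Psi nu x) dd pi L (`|mu - nu| / m) L0
    (pi_ge0 R).
  rewrite p0 n0 subrr => /(_ erefl) h.
  apply: le_trans (h _ _ pi _) _.
  - by move=> x xpi; exact: (derivB (pd x xpi) (nd x xpi)).
  - move=> x xpi.
    have -> : dd x = rate mu x * (sin (Psi mu x) ^+ 2 - sin (Psi nu x) ^+ 2) +
                     (mu - nu) / m * sin (Psi nu x) ^+ 2.
      by rewrite /dd /rate; field; rewrite gt_eqF.
    apply: le_trans (ler_normD _ _) _; rewrite lerD//.
      by rewrite normrM /L -mulrA mulrCA ler_pM// sin_sqr_lipschitz.
    rewrite normrM normrX normrM normfV (gtr0_norm m0) ler_piMr//.
      by rewrite divr_ge0// ltW.
    by rewrite exprn_ile1// sin_max.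
  - by rewrite lexx pi_ge0.
  - by rewrite /C le_eqVlt; apply/orP; left; apply/eqP; ring.
apply/cvgrPdist_lt => eps eps0.
have d0 : 0 < eps / (C + 1) by rewrite divr_gt0// ltr_wpDl.
near=> nu; apply: le_lt_trans (key nu) _.
apply: (@le_lt_trans _ _ (`|mu - nu| * (C + 1))).
  by rewrite ler_wpM2l// lerDl.
have C1 : 0 < C + 1 by rewrite ltr_wpDl.
rewrite -ltr_pdivlMr//; near: nu.
Unshelve. all: by end_near. Qed.

(** Below the potential the angle cannot cross pi / 2: there its derivative is
    (mu - q) / m <= 0. *)
Lemma pruefer_small mu psi : (forall x, mu <= q x) -> pruefer q m mu psi ->
  psi pi <= pi / 2.
Proof.
move=> muq [p0 cp pd]; rewrite -subr_le0.
apply: (@comparison R (fun x => psi x - pi / 2)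
  (fun x => m + rate mu x * sin (psi x) ^+ 2 - 0) 0 pi m); last by rewrite pi_ge0 lexx.
- by move=> x xpi; exact: (derivB (pd x xpi) (derivC _ x)).
- by rewrite p0 sub0r oppr_le0 divr_ge0// pi_ge0.
- move=> x xpi w0; set w := psi x - pi / 2 in w0 *.
  have -> : psi x = w + pi / 2 by rewrite subrK.
  rewrite sinDpihalf.
  have h1 := sin_sqr_le (ltW w0); have h2 := cos2Dsin2 w.
  have h3 : 0 <= - ((mu - q x) / m).
    by rewrite -mulNr divr_ge0 ?(ltW m0)// oppr_ge0 subr_le0.
  have h4 : 0 <= cos w ^+ 2 by exact: sqr_ge0.
  have := mulr_ge0 h3 h4; have := ler_wpM2l (ltW m0) h1.
  have -> : cos w ^+ 2 = 1 - sin w ^+ 2 by rewrite -h2 addrK.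
  rewrite /rate; lra.
Qed.

(** The coefficient of sin ^ 2 is nonnegative here, so the angle has slope at
    least m. *)
Lemma pruefer_large mu psi : (forall x, m ^+ 2 + q x <= mu) ->
  pruefer q m mu psi -> m * pi <= psi pi.
Proof.
move=> muq [p0 cp pd]; rewrite -subr_ge0.
have -> : 0 = psi 0 - m * 0 by rewrite p0 mulr0 subr0.
apply: (@deriv_ge0_le R (fun x => psi x - m * x)
  (fun x => m + rate mu x * sin (psi x) ^+ 2 - m * 1)).
- exact: pi_ge0.
- by move=> x xpi; exact: (derivB (pd x xpi) (derivZ m (deriv_id x))).
- move=> x _; rewrite mulr1 addrAC subrr add0r mulr_ge0 ?sqr_ge0//.
  by rewrite /rate subr_ge0 ler_pdivlMr// -expr2 lerBrDr.
Qed.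

(** A multiple of pi is a barrier: where the deficit w = j pi - psi is positive,
    w' <= C sin ^ 2 w <= C w. *)
Lemma pruefer_level_le mu psi j x0 x1 : pruefer q m mu psi ->
  psi x0 = j%:R * pi -> 0 <= x0 -> x0 <= x1 <= pi -> j%:R * pi <= psi x1.
Proof.
move=> [p0 cp pd] e x00 /andP[x01 x1pi]; rewrite -subr_le0.
apply: (@comparison R (fun x => j%:R * pi - psi x)
  (fun x => 0 - (m + rate mu x * sin (psi x) ^+ 2)) x0 pi (rmax mu)).
- move=> x /andP[x0x xpi]; apply: (derivB (derivC _ x) (pd x _)).
  by rewrite (le_trans x00).
- by rewrite e subrr.
- move=> x _ w0; set w := j%:R * pi - psi x in w0 *.
  have -> : sin (psi x) ^+ 2 = sin w ^+ 2 by rewrite sin_sqrBnatpi.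
  have h1 := sin_sqr_le (ltW w0); have h2 := rate_max mu x.
  have h3 : - (rate mu x * sin w ^+ 2) <= rmax mu * w.
    apply: le_trans (ler_norm _) _; rewrite normrN normrM ler_pM//.
    by rewrite ger0_norm// sqr_ge0.
  by rewrite sub0r opprD (le_trans _ h3)// gerDr oppr_le0 ltW.
- by rewrite x01.
Qed.

(** At a multiple of pi the angle has slope m > 0: it takes this value once. *)
Lemma pruefer_level_lt mu psi j x0 x1 : pruefer q m mu psi ->
  psi x0 = j%:R * pi -> 0 <= x0 -> x0 < x1 <= pi -> j%:R * pi < psi x1.
Proof.
move=> HP e x00 /andP[x01 x1pi]; rewrite lt_neqAle.
rewrite (pruefer_level_le HP e x00) ?(ltW x01) ?x1pi// andbT.
apply/eqP => e1; have [p0 cp pd] := HP.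
have x1I : 0 <= x1 <= pi by rewrite x1pi (le_trans x00 (ltW x01)).
have d := pd x1 x1I.
rewrite -e1 sin_natpi expr0n mulr0 addr0 in d.
have : \forall h \near 0^', 0 < h^-1 *: (psi (h *: 1 + x1) - psi x1).
  have [dv de] := d.
  have : h^-1 *: (psi (h *: 1 + x1) - psi x1) @[h --> 0^'] --> m.
    by rewrite -de; exact: dv.
  by move=> /cvgr_gt/(_ 0 m0).
move=> /nbhs_ballP[r/= r0 hr].
pose h := - (Num.min (r / 2) ((x1 - x0) / 2)).
have h0 : h < 0.
  by rewrite oppr_lt0 lt_min !divr_gt0// subr_gt0.
(* h is negative, small, and x1 + h stays to the right of x0 *)
have hlr : `|h| < r.
  rewrite normrN gtr0_norm -?oppr_lt0// gt_min; apply/orP; left.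
  by rewrite ltr_pdivrMr// ltr_pMr// ltr1n.
have := hr h; rewrite /ball/= sub0r normrN => /(_ hlr); rewrite lt_eqF// => /(_ isT).
rewrite /GRing.scale/= nmulr_rgt0 ?invr_lt0// mulr1 subr_lt0 -e1.
rewrite ltNge => /negP; apply; apply: (pruefer_level_le HP e x00).
have : Num.min (r / 2) ((x1 - x0) / 2) <= (x1 - x0) / 2 by rewrite ge_min lexx orbT.
rewrite /h; move: h0; rewrite /h; move: x1pi x01.
set w := Num.min _ _; lra.
Qed.

End Angle.

(** The intermediate value theorem in mu, from the top down, produces the
    energies at which the angle ends on a given multiple of pi. *)
Lemma pruefer_energies q M n : continuous q -> (forall x, `|q x| <= M) ->
  exists (mu : nat -> R) (psi : nat -> R -> R),
    (forall k, (0 < k <= n)%N ->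
       pruefer q n%:R (mu k) (psi k) /\ psi k pi = k%:R * pi) /\
    (forall k, (0 < k < n)%N -> mu k < mu k.+1).
Proof.
move=> cq qM; case: n => [|n].
  by exists (fun=> 0), (fun=> id); split => -[].
set m : R := n.+1%:R; have m0 : 0 < m by rewrite ltr0n.
have /choice[Psi HPsi] := fun mu => pruefer_exists cq qM m0 mu.
have cPsi := pruefer_cont qM m0 HPsi.
have pi0 := pi_gt0 R.
(* at - M the angle ends before pi, at m ^ 2 + M it ends at m pi or beyond *)
pose lo := - M; pose hi := m ^+ 2 + M.
have Plo : Psi lo pi <= pi / 2.
  apply: (pruefer_small m0 _ (HPsi lo)) => x.
  by have := qM x; rewrite ler_norml /lo => /andP[].
have Phi : m * pi <= Psi hi pi.
  apply: (pruefer_large m0 _ (HPsi hi)) => x; rewrite lerD2l.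
  exact: le_trans (ler_norm _) (qM x).
have lohi : lo <= hi.
  have M0 : 0 <= M by exact: le_trans (normr_ge0 _) (qM 0).
  by rewrite /lo /hi; have := sqr_ge0 m; lra.
suff main k h : lo <= h -> k%:R * pi <= Psi h pi -> exists mu : nat -> R,
    [/\ forall j, (0 < j <= k)%N -> Psi (mu j) pi = j%:R * pi,
        forall j, (0 < j < k)%N -> mu j < mu j.+1 & (0 < k)%N -> mu k <= h].
  have [mu [mu1 mu2 _]] := main n.+1 hi lohi Phi.
  exists mu, (fun k => Psi (mu k)); split=> // k kn; split; first exact: HPsi.
  exact: mu1.
elim: k h => [|k IH] h loh kh.
  by exists (fun=> 0); split=> // -[|j] /andP[].
have [c cI Pc] : exists2 c, c \in `[lo, h] & Psi c pi = k.+1%:R * pi.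
  apply: (@IVT R (fun mu => Psi mu pi)) => //; first exact: continuous_subspaceT.
  rewrite ge_min le_max kh orbT andbT; apply/orP; left; apply: le_trans Plo _.
  by rewrite mulrC ler_pM2r//; apply: (@le_trans _ _ 1); [lra|rewrite ler1n].
move: cI; rewrite in_itv/= => /andP[loc ch].
have [|mu [mu1 mu2 mu3]] := IH c loc.
  by rewrite Pc ler_pM2r// ler_nat.
exists (fun j => if (j <= k)%N then mu j else c); split.
- move=> j /andP[j0]; rewrite leq_eqVlt => /orP[/eqP->|jk]; first by rewrite ltnn.
  by rewrite -ltnS jk; apply: mu1; rewrite j0.
- move=> j /andP[j0 jk]; rewrite -ltnS jk.
  case: ltnP => jk'; first by apply: mu2; rewrite j0.
  have ejk : j = k by apply/eqP; rewrite eqn_leq -ltnS jk.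
  rewrite -ejk in mu1 mu3 Pc.
  rewrite lt_neqAle mu3// andbT; apply/eqP => e.
  have := mu1 j; rewrite j0 leqnn => /(_ isT); rewrite e Pc.
  by move=> /(mulIf (lt0r_neq0 pi0))/eqP; rewrite eqr_nat gtn_eqF.
- by rewrite ltnn.
Qed.

End Pruefer.

(** * Dirichlet forms and Jacobi's inequality *)

Section QuotientAtZero.
Variable R : realType.

(** Where f and s vanish together, s simply, f ^ 2 c / s has a derivative: with
    the convention 1 / 0 = 0 it is defined, and equal to 0, at the zero. *)
Lemma deriv_sqr_div_zero (f s c : R -> R) (z a d : R) :
  is_derive z 1 f a -> is_derive z 1 s d -> {for z, continuous c} ->
  f z = 0 -> s z = 0 -> d != 0 ->
  is_derive z 1 (fun x => f x ^+ 2 * c x / s x) (a ^+ 2 * c z / d).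
Proof.
move=> [fv fe] [sv se] cc fz sz d0.
suff H : h^-1 *: (f (h *: 1 + z) ^+ 2 * c (h *: 1 + z) / s (h *: 1 + z) -
    f z ^+ 2 * c z / s z) @[h --> 0^'] --> a ^+ 2 * c z / d.
  apply: DeriveDef; last exact: (cvg_lim _ H).
  by apply/cvg_ex; exists (a ^+ 2 * c z / d).
have fl : h^-1 *: (f (h *: 1 + z) - f z) @[h --> 0^'] --> a.
  by rewrite -fe; exact: fv.
have sl : h^-1 *: (s (h *: 1 + z) - s z) @[h --> 0^'] --> d.
  by rewrite -se; exact: sv.
have cl : c (h *: 1 + z) @[h --> 0^'] --> c z.
  have hz : h *: 1 + z @[h --> (0:R)^'] --> z.
    apply: cvg_within_filter.
    have /(_ 0) := contD (contM (@cont_id R) (@contC R 1)) (@contC R z).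
    by rewrite /continuous_at mul0r add0r.
  exact: (cvg_comp _ _ hz cc).
rewrite [a ^+ 2]expr2; apply: cvg_trans (cvgM (cvgM (cvgM fl fl) cl) (cvgV d0 sl)).
apply: near_eq_cvg; near=> h.
have h0 : h != 0 by near: h; exact: nbhs_dnbhs_neq.
rewrite /= fz sz expr0n !mul0r !subr0 /GRing.scale/= invfM invrK.
by move: (s _)^-1 => si; field.
Unshelve. all: by end_near. Qed.

End QuotientAtZero.

Section Forms.
Variable R : realType.
Implicit Types (q w f df g dg u du psi : R -> R) (a c mu Gam m : R).

(** A function of the form domain is carried along with its derivative, in which
    the energy form is explicit. *)
Definition dirichlet_C1 f df :=
  [/\ continuous f, continuous df,
      forall x, 0 <= x <= pi -> is_derive x 1 f (df x), f 0 = 0 & f pi = 0].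

(** The energy (a = 1, w = q) and the mean square product (a = 0, w = 1) are
    instances of one form, whose bilinearity is proved once. *)
Definition form a w f df g dg : R :=
  integ (fun x => a * (df x * dg x) + w x * (f x * g x)).

Definition energy q f df g dg := form 1 q f df g dg.

Definition ip f g : R := integ (fun x => f x * g x).

Lemma formC a w f df g dg : form a w f df g dg = form a w g dg f df.
Proof. by apply: integ_ext => x _; rewrite [df x * _]mulrC [f x * _]mulrC. Qed.

Lemma ipC f g : ip f g = ip g f.
Proof. by apply: integ_ext => x _; rewrite mulrC. Qed.

Lemma ip_form f df g dg : ip f g = form 0 (fun=> 1) f df g dg.
Proof. by apply: integ_ext => x _; rewrite mul0r add0r mul1r. Qed.

Lemma cont_form a w f df g dg : continuous w -> continuous f -> continuous df ->
  continuous g -> continuous dg ->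
  continuous (fun x => a * (df x * dg x) + w x * (f x * g x)).
Proof.
move=> cw cf cdf cg cdg; apply: contD; apply: contM => //; try exact: contM.
exact: contC.
Qed.

Lemma dirichlet_C1_comb n f df (u du : 'I_n -> R -> R) (c : 'I_n -> R) :
  dirichlet_C1 f df -> (forall j, dirichlet_C1 (u j) (du j)) ->
  dirichlet_C1 (fun x => f x - \sum_j c j * u j x)
               (fun x => df x - \sum_j c j * du j x).
Proof.
move=> [cf cdf fd f0 fpi] Hu; split.
- apply: contB => //; apply: cont_sum => j; apply: contM; first exact: contC.
  by have [] := Hu j.
- apply: contB => //; apply: cont_sum => j; apply: contM; first exact: contC.
  by have [] := Hu j.
- move=> x xpi; apply: (derivB (fd x xpi)); apply: deriv_sum => j.
  by have [_ _ ud _ _] := Hu j; exact: (derivZ (c j) (ud x xpi)).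
- rewrite f0 big1 ?subr0// => j _; have [_ _ _ -> _] := Hu j; exact: mulr0.
- rewrite fpi big1 ?subr0// => j _; have [_ _ _ _ ->] := Hu j; exact: mulr0.
Qed.

Lemma form_comb n a w f df g dg (u du : 'I_n -> R -> R) (c : 'I_n -> R) :
  continuous w -> dirichlet_C1 f df -> dirichlet_C1 g dg ->
  (forall j, dirichlet_C1 (u j) (du j)) ->
  form a w (fun x => f x - \sum_j c j * u j x)
           (fun x => df x - \sum_j c j * du j x) g dg =
  form a w f df g dg - \sum_j c j * form a w (u j) (du j) g dg.
Proof.
move=> cw [cf cdf _ _ _] [cg cdg _ _ _] Hu.
have cu j : continuous (fun x => a * (du j x * dg x) + w x * (u j x * g x)).
  by have [? ? _ _ _] := Hu j; exact: cont_form.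
have -> : \sum_j c j * form a w (u j) (du j) g dg =
  integ (fun x => \sum_j c j * (a * (du j x * dg x) + w x * (u j x * g x))).
  rewrite integ_sum; last by move=> j; apply: contM => //; exact: contC.
  by apply: eq_bigr => j _; rewrite integZ.
rewrite -integB; last 2 first.
- exact: cont_form.
- by apply: cont_sum => j; apply: contM => //; exact: contC.
apply: integ_ext => x _; rewrite !mulrBl !mulrBr !mulr_suml !mulr_sumr.
under [in RHS]eq_bigr do rewrite mulrDr.
rewrite big_split/= !opprD.
have -> : \sum_(i < n) a * (c i * du i x * dg x) =
          \sum_(i < n) c i * (a * (du i x * dg x)) by apply: eq_bigr => i _; ring.
have -> : \sum_(i < n) w x * (c i * u i x * g x) =
          \sum_(i < n) c i * (w x * (u i x * g x)) by apply: eq_bigr => i _; ring.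
by ring.
Qed.

Lemma ip_comb n f df g dg (u du : 'I_n -> R -> R) (c : 'I_n -> R) :
  dirichlet_C1 f df -> dirichlet_C1 g dg ->
  (forall j, dirichlet_C1 (u j) (du j)) ->
  ip (fun x => f x - \sum_j c j * u j x) g = ip f g - \sum_j c j * ip (u j) g.
Proof.
move=> Df Dg Du.
rewrite (@ip_form _ (fun x => df x - \sum_j c j * du j x) _ dg) form_comb//.
  by rewrite -ip_form; under eq_bigr do rewrite -ip_form.
exact: contC.
Qed.

(** Jacobi's argument: for P = m cot psi, the logarithmic derivative of a
    solution of - u'' + q u = Gam u, one has
      f' ^ 2 + (q - Gam) f ^ 2 = (f ^ 2 P)' + (f' - f P) ^ 2,
    and f ^ 2 P extends differentiably over the zeros of sin psi. *)
Lemma jacobi_energy q Gam m psi f df : continuous q -> 0 < m ->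
  pruefer q m Gam psi -> dirichlet_C1 f df ->
  (forall x, 0 <= x <= pi -> sin (psi x) = 0 -> f x = 0) ->
  Gam * ip f f <= energy q f df f df.
Proof.
move=> cq m0 [p0 cp pd] [cf cdf fd f0 fpi] fz.
pose h x := df x * df x + (q x - Gam) * (f x * f x).
have ch : continuous h.
  apply: contD; first exact: contM.
  by apply: contM; [apply: contB => //; exact: contC|exact: contM].
have [H [H0 Hd]] := primitive ch.
pose G x := f x ^+ 2 * (m * cos (psi x)) / sin (psi x).
(* the square completed by Jacobi, the derivative of H - G *)
pose S x := if sin (psi x) == 0 then 0
            else (df x - f x * (m * cos (psi x) / sin (psi x))) ^+ 2.
have HGd x : 0 <= x <= pi -> is_derive x 1 (fun x => H x - G x) (S x).
  move=> xpi; have psd := pd x xpi; have ff := fd x xpi.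
  have sd := deriv_comp psd (is_derive_sin _).
  have cd := derivZ m (deriv_comp psd (is_derive_cos _)).
  rewrite /S; case: eqP => [sx|/eqP sx].
    have cx2 : cos (psi x) ^+ 2 = 1.
      by rewrite -(cos2Dsin2 (psi x)) sx expr0n addr0.
    have cx0 : cos (psi x) != 0 by rewrite -sqrf_eq0 cx2 oner_eq0.
    rewrite sx expr0n mulr0 addr0 in sd.
    have fx0 : f x = 0 by exact: fz.
    have d0 : cos (psi x) * m != 0 by rewrite mulf_neq0// gt_eqF.
    apply: is_derive_eq (derivB (Hd x)
      (deriv_sqr_div_zero ff sd (deriv_cont cd) fx0 sx d0)) _.
    by rewrite /h fx0; field; rewrite cx0 gt_eqF.
  have := derivM (derivM (derivM ff ff) cd) (derivV sx sd).
  have -> : (fun t => f t * f t * (m * cos (psi t)) * (sin (psi t))^-1) = G.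
    by apply/funext => t; rewrite /G expr2.
  move=> Gd; apply: is_derive_eq (derivB (Hd x) Gd) _.
  have c2 : cos (psi x) ^+ 2 = 1 - sin (psi x) ^+ 2.
    by rewrite -(cos2Dsin2 (psi x)) addrK.
  rewrite /h; field: c2; rewrite sx gt_eqF//.
have : H 0 - G 0 <= H pi - G pi.
  apply: (@deriv_ge0_le R (fun x => H x - G x) S 0 pi (pi_ge0 R)) => //.
  by move=> x _; rewrite /S; case: ifP => // _; exact: sqr_ge0.
rewrite /G f0 fpi expr0n !mul0r !subr0 -subr_ge0.
rewrite -(integ_deriv ch (fun x _ => Hd x)) -subr_ge0 subr0 => hge.
rewrite -subr_ge0; apply: le_trans hge _; rewrite le_eqVlt; apply/orP; left.
apply/eqP; rewrite /energy /form /ip.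
have cff : continuous (fun x => f x * f x) by exact: contM.
rewrite -integZ// -integB; last 2 first.
- by apply: (@cont_form 1).
- by apply: contM => //; exact: contC.
by apply: integ_ext => x _; rewrite /h; ring.
Qed.

End Forms.

(** * Eigenfunctions and the trace inequality *)

Section Eigenfunctions.
Variable R : realType.
Implicit Types (q w f df g dg u du psi : R -> R) (a c mu Gam m : R).

Definition eigenfunction q mu u du :=
  [/\ dirichlet_C1 u du,
      forall x, 0 <= x <= pi -> is_derive x 1 du ((q x - mu) * u x) &
      ip u u = 1].

Lemma integ_eq0 f : continuous f -> (forall x, 0 <= x <= pi -> 0 <= f x) ->
  integ f = 0 -> forall x, 0 < x < pi -> f x = 0.
Proof.
move=> cf f0 If x /andP[x0 xpi]; have [F [F0 Fd]] := primitive cf.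
have Fpi : F pi = 0.
  by rewrite -If (integ_deriv cf (fun x _ => Fd x)) F0 subr0.
have Fle a b : 0 <= a -> a <= b -> b <= pi -> F a <= F b.
  move=> a0 ab bpi; apply: (@deriv_ge0_le R F f a b ab) => // y /andP[ay yb].
  by apply: f0; rewrite (le_trans a0 ay) (le_trans yb bpi).
have FE y : 0 <= y <= pi -> F y = 0.
  move=> /andP[y0 ypi]; apply/eqP; rewrite eq_le -{1}Fpi -F0.
  by rewrite !Fle.
have d : is_derive x 1 F 0.
  apply: (near_eq_is_derive _ (derivC 0 x)) => //; near=> y; rewrite FE//.
  apply/andP; split; apply/ltW; near: y; first exact: lt_nbhsr.
  exact: lt_nbhsl.
exact: deriv_uniq (Fd x) d.
Unshelve. all: by end_near. Qed.

(** In Pruefer's coordinates u = r sin psi and u' = m r cos psi, where the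
    logarithm of the amplitude r is the primitive of
    - sin psi cos psi ((mu - q) / m - m). *)
Lemma eigenfunction_exists q m mu psi k : continuous q -> 0 < m ->
  pruefer q m mu psi -> psi pi = k%:R * pi -> exists u du, eigenfunction q mu u du.
Proof.
move=> cq m0 [p0 cp pd] ppi.
pose rate x := (mu - q x) / m - m.
have crate : continuous rate.
  by apply: contB; [apply: contM; [apply: contB|]|]; (exact: contC || exact: cq).
have csin : continuous (fun x => sin (psi x)).
  by apply: cont_comp cp _; exact: continuous_sin.
have ccos : continuous (fun x => cos (psi x)).
  by apply: cont_comp cp _; exact: continuous_cos.
have cr' : continuous (fun x => - (sin (psi x) * cos (psi x) * rate x)).
  by apply: contN; apply: contM => //; exact: contM.
have [r [_ rd]] := primitive cr'.
pose v x := expR (r x) * sin (psi x).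
pose dv x := m * (expR (r x) * cos (psi x)).
have rer x := deriv_comp (rd x) (is_derive_expR (r x)).
have cer : continuous (fun x => expR (r x)) by exact: deriv_continuous rer.
have cv : continuous v by exact: contM.
have cdv : continuous dv by apply: contM; [exact: contC|exact: contM].
have vd x : 0 <= x <= pi -> is_derive x 1 v (dv x).
  move=> xpi; have sd := deriv_comp (pd x xpi) (is_derive_sin _).
  apply: is_derive_eq (derivM (rer x) sd) _.
  have c2 : cos (psi x) ^+ 2 = 1 - sin (psi x) ^+ 2.
    by rewrite -(cos2Dsin2 (psi x)) addrK.
  by rewrite /dv -/(rate x); ring.
have dvd x : 0 <= x <= pi -> is_derive x 1 dv ((q x - mu) * v x).
  move=> xpi; have cd := deriv_comp (pd x xpi) (is_derive_cos _).
  apply: is_derive_eq (derivZ m (derivM (rer x) cd)) _.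
  have c2 : cos (psi x) ^+ 2 = 1 - sin (psi x) ^+ 2.
    by rewrite -(cos2Dsin2 (psi x)) addrK.
  by rewrite /v /rate; field: c2; rewrite gt_eqF.
have v0 : v 0 = 0 by rewrite /v p0 sin0 mulr0.
have vpi : v pi = 0 by rewrite /v ppi sin_natpi mulr0.
have cvv : continuous (fun x => v x * v x) by exact: contM.
pose N := ip v v.
have N0 : 0 < N.
  rewrite lt_def; apply/andP; split; last first.
    by apply: integ_ge0 => // x _; rewrite -expr2 sqr_ge0.
  apply/eqP => NE.
  have vz x : 0 < x < pi -> v x = 0.
    move=> xpi; apply/eqP; rewrite -(sqrf_eq0 (v x)) expr2.
    apply/eqP; apply: (integ_eq0 cvv _ NE) => // y _.
    by rewrite -expr2 sqr_ge0.
  have pi0 := pi_gt0 R.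
  have hI : 0 < (pi / 2 : R) < pi by apply/andP; split; lra.
  have d0 : is_derive (pi / 2) 1 v 0.
    apply: (near_eq_is_derive _ (derivC 0 (pi / 2))) => //; near=> y.
    rewrite vz//; apply/andP; split; near: y; [apply: lt_nbhsr|apply: lt_nbhsl];
      by case/andP: hI.
  have hI' : 0 <= (pi / 2 : R) <= pi by case/andP: hI => /ltW-> /ltW->.
  have := deriv_uniq d0 (vd _ hI'); rewrite /dv => /esym/eqP.
  rewrite !mulf_eq0 (gt_eqF m0) (gt_eqF (expR_gt0 _)) => /eqP c0.
  have := vz _ hI; rewrite /v => /eqP; rewrite mulf_eq0 gt_eqF ?expR_gt0//= => /eqP s0.
  have := cos2Dsin2 (psi (pi / 2)); rewrite c0 s0 expr0n addr0 => /esym/eqP.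
  by rewrite oner_eq0.
pose k0 := (Num.sqrt N)^-1.
have k2 : k0 * k0 * N = 1.
  by rewrite -expr2 exprVn sqr_sqrtr ?ltW// mulVf// gt_eqF.
exists (fun x => k0 * v x), (fun x => k0 * dv x); split; first split.
- by apply: contM => //; exact: contC.
- by apply: contM => //; exact: contC.
- by move=> x xpi; exact: (derivZ k0 (vd x xpi)).
- by rewrite v0 mulr0.
- by rewrite vpi mulr0.
- move=> x xpi; apply: is_derive_eq (derivZ k0 (dvd x xpi)) _.
  by rewrite mulrCA.
- rewrite /ip -[RHS]k2 /N /ip -integZ//; apply: integ_ext => x _; ring.
Unshelve. all: by end_near. Qed.

(** Integration by parts: (u' g)' = u' g' + (q - mu) u g. *)
Lemma energy_eigen q mu u du g dg : continuous q -> eigenfunction q mu u du ->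
  dirichlet_C1 g dg -> energy q u du g dg = mu * ip u g.
Proof.
move=> cq [[cu cdu ud u0 upi] dud _] [cg cdg gd g0 gpi].
have cug : continuous (fun x => u x * g x) by exact: contM.
apply/eqP; rewrite -subr_eq0 /ip -integZ// /energy /form -integB; last 2 first.
- by apply: (@cont_form _ 1).
- by apply: contM => //; exact: contC.
have h x : 0 <= x <= pi -> is_derive x 1 (fun x => du x * g x)
    (1 * (du x * dg x) + q x * (u x * g x) - mu * (u x * g x)).
  move=> xpi; apply: is_derive_eq (derivM (dud x xpi) (gd x xpi)) _; ring.
rewrite (integ_deriv _ h); last first.
  apply: contB; first exact: (@cont_form _ 1).
  by apply: contM => //; exact: contC.
by rewrite g0 gpi !mulr0 subrr.
Qed.

Lemma eigenfunction_orthogonal q mu nu u du v dv : continuous q ->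
  eigenfunction q mu u du -> eigenfunction q nu v dv -> mu != nu -> ip u v = 0.
Proof.
move=> cq Eu Ev mn; have [Du _ _] := Eu; have [Dv _ _] := Ev.
have e1 := energy_eigen cq Eu Dv; have e2 := energy_eigen cq Ev Du.
rewrite /energy formC in e2; rewrite /energy e2 ipC in e1.
apply/eqP; move/eqP: e1; rewrite eq_sym -subr_eq0 -mulrBl mulf_eq0 subr_eq0.
by rewrite (negbTE mn)/= ipC.
Qed.

End Eigenfunctions.

Section Trace.
Variable R : realType.
Variables (q : R -> R) (n : nat) (mu : 'I_n -> R) (u du : 'I_n -> R -> R).
Variables (Gam m : R) (psi : R -> R).
Hypotheses (cq : continuous q) (m0 : 0 < m).
Hypothesis (q_bounded : exists M, forall x, `|q x| <= M).
Hypothesis Eu : forall j, eigenfunction q (mu j) (u j) (du j).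
Hypothesis mu_inj : injective mu.
Hypothesis muG : forall j, mu j < Gam.
Hypotheses (Hpsi : pruefer q m Gam psi) (psi_pi : psi pi = n.+1%:R * pi).

Let Du j : dirichlet_C1 (u j) (du j).
Proof. by have [] := Eu j. Qed.

Let ip_u i j : ip (u i) (u j) = (i == j)%:R.
Proof.
case: eqVneq => [<-|ij]; first by have [_ _ ->] := Eu i.
by apply: (eigenfunction_orthogonal cq (Eu i) (Eu j)); rewrite (inj_eq mu_inj).
Qed.

(** The angle at level Gam has no more than n multiples of pi inside the
    interval, so n point conditions suffice to apply Jacobi's argument. *)
Lemma few_nodes : exists z : 'I_n -> R,
  (forall i, 0 <= z i <= pi) /\
  forall x, 0 < x < pi -> sin (psi x) = 0 -> exists i, x = z i.
Proof.
have [M qM] := q_bounded; have [p0 cp pd] := Hpsi.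
have /choice[z Hz] : forall i : 'I_n, exists z, 0 <= z <= pi /\
    ((exists2 x, 0 < x < pi & psi x = i.+1%:R * pi) ->
      0 < z < pi /\ psi z = i.+1%:R * pi).
  move=> i; have [[x xpi xE]|nx] :=
      pselect (exists2 x, 0 < x < pi & psi x = i.+1%:R * pi).
    by exists x; split=> //; case/andP: xpi => /ltW-> /ltW->.
  by exists 0; rewrite lexx pi_ge0.
exists z; split=> [i|x xI sx]; first by have [] := Hz i.
have /andP[x0 xpi] := xI.
have psx0 : 0 < psi x.
  rewrite -[X in X < _](mul0r pi) -[X in X * _]/(0%:R).
  by apply: (pruefer_level_lt qM m0 Hpsi) (lexx 0) _; rewrite ?p0 ?mul0r// x0 ltW.
have psxn : psi x < n.+1%:R * pi.
  rewrite ltNge; apply/negP => h.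
  have [y] : exists2 y, y \in `[0, x] & psi y = n.+1%:R * pi.
    apply: IVT (ltW x0) _ _; first exact: continuous_subspaceT.
    by rewrite p0 ge_min le_max h orbT mulr_ge0// ?pi_ge0.
  rewrite in_itv/= => /andP[y0 yx] ye.
  have := pruefer_level_lt qM m0 Hpsi ye y0 (x1 := pi).
  by rewrite (le_lt_trans yx xpi) lexx psi_pi ltxx => /(_ isT).
have [|[//|j] /= jn xE] := sin_eq0_natpi _ sx (n := n).
  by rewrite psx0.
exists (Ordinal jn); have [_ []] := Hz (Ordinal jn); first by exists x.
move=> /andP[z0 zpi] ze; set zz := z _ in z0 zpi ze *.
have [xz|zx|//] := ltgtP x zz.
  have := pruefer_level_lt qM m0 Hpsi xE (ltW x0) (x1 := zz).
  by rewrite xz ltW// ze ltxx => /(_ isT).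
have := pruefer_level_lt qM m0 Hpsi ze (ltW z0) (x1 := x).
by rewrite zx ltW// xE ltxx => /(_ isT).
Qed.

Let D0 : @dirichlet_C1 R (fun=> 0) (fun=> 0).
Proof. by split=> // [||x _]; [exact: contC|exact: contC|exact: derivC]. Qed.

(** As the u j diagonalise both forms, subtracting a combination of them changes
    energy - Gam * ip by a sum of squares to be completed. *)
Let form_defect f df c : dirichlet_C1 f df ->
  let h x := f x - \sum_j c j * u j x in
  let dh x := df x - \sum_j c j * du j x in
  energy q h dh h dh - Gam * ip h h =
  energy q f df f df - Gam * ip f f +
  \sum_j (Gam - mu j) * (2 * c j * ip f (u j) - c j ^+ 2).
Proof.
move=> Df h dh; have Dh : dirichlet_C1 h dh by exact: dirichlet_C1_comb.
have ipuh j : ip (u j) h = ip f (u j) - c j.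
  rewrite ipC (ip_comb _ Df (Du j) Du) (bigD1 j)//= ip_u eqxx mulr1.
  rewrite big1 ?addr0// => i ij; by rewrite ip_u (negbTE ij) mulr0.
have e1 : energy q h dh h dh =
    energy q f df h dh - \sum_j c j * (mu j * (ip f (u j) - c j)).
  rewrite {1}/energy (form_comb _ _ cq Df Dh Du); congr (_ - _).
  by apply: eq_bigr => j _; rewrite -/(energy _ _ _ _ _)
    (energy_eigen cq (Eu j) Dh) ipuh.
have e2 : energy q f df h dh = energy q f df f df - \sum_j c j * (mu j * ip f (u j)).
  rewrite {1}/energy formC (form_comb _ _ cq Df Df Du); congr (_ - _).
  by apply: eq_bigr => j _; rewrite -/(energy _ _ _ _ _)
    (energy_eigen cq (Eu j) Df) ipC.
have e3 : ip h h = ip f h - \sum_j c j * (ip f (u j) - c j).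
  rewrite {1}/h (ip_comb _ Df Dh Du); congr (_ - _).
  by apply: eq_bigr => j _; rewrite ipuh.
have e4 : ip f h = ip f f - \sum_j c j * ip f (u j).
  rewrite ipC (ip_comb _ Df Df Du); congr (_ - _).
  by apply: eq_bigr => j _; rewrite ipC.
rewrite e1 e2 e3 e4 !mulrBr !mulr_sumr !opprB.
have -> : \sum_j (Gam - mu j) * (2 * c j * ip f (u j) - c j ^+ 2) =
  \sum_j Gam * (c j * ip f (u j)) + \sum_j Gam * (c j * (ip f (u j) - c j))
  - \sum_j c j * (mu j * ip f (u j)) - \sum_j c j * (mu j * (ip f (u j) - c j)).
  rewrite -!big_split/= -!sumrB; apply: eq_bigr => j _; ring.
ring.
Qed.

(** The energy of f is at least what it would be if all of f outside the span of
    the u j had energy density Gam.  The coefficients c are chosen to make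
    f - \sum_j c j * u j vanish at the nodes. *)
Lemma energy_ge f df : dirichlet_C1 f df ->
  Gam * ip f f - \sum_j (Gam - mu j) * ip f (u j) ^+ 2 <= energy q f df f df.
Proof.
move=> Df; have [z [zI Hz]] := few_nodes.
(* Jacobi's inequality for g minus an interpolating combination *)
have key g dg c : dirichlet_C1 g dg ->
    (forall i, g (z i) = \sum_j c j * u j (z i)) ->
    0 <= energy q g dg g dg - Gam * ip g g +
      \sum_j (Gam - mu j) * (2 * c j * ip g (u j) - c j ^+ 2).
  move=> Dg gz; rewrite -form_defect// subr_ge0.
  have Dh := dirichlet_C1_comb c Dg Du.
  apply: (jacobi_energy cq m0 Hpsi Dh) => x /andP[x0 xpi] sx.
  have [_ _ _ h0 hpi] := Dh.
  move: x0; rewrite le_eqVlt => /predU1P[<-//|x0].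
  move: xpi; rewrite le_eqVlt => /predU1P[->//|xpi].
  have [|i ->] := Hz x _ sx; first by rewrite x0.
  by rewrite gz subrr.
pose A := \matrix_(j < n, i < n) u j (z i).
(* a combination vanishing at all nodes satisfies Jacobi's inequality at level Gam,
   but its energies are below Gam: it is 0 *)
have uA : A \in unitmx.
  rewrite -row_free_unit; apply: inj_row_free => v vA.
  have vz i : (0 : R) = \sum_j v 0 j * u j (z i).
    move/rowP: vA => /(_ i); rewrite !mxE => e; rewrite -[LHS]e.
    by apply: eq_bigr => j _; rewrite mxE.
  have := key _ _ (fun j => v 0 j) D0 vz.
  have ip0 g : ip (fun=> 0) g = 0 :> R.
    by rewrite /ip -[RHS]integ0; apply: integ_ext => x _; rewrite mul0r.
  have -> : energy q (fun=> 0) (fun=> 0) (fun=> 0) (fun=> 0) = 0.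
    by rewrite -[RHS]integ0; apply: integ_ext => x _; rewrite !mulr0 addr0.
  under eq_bigr do rewrite ip0 mulr0 sub0r mulrN.
  rewrite ip0 mulr0 subr0 add0r sumrN oppr_ge0 => h.
  apply/rowP => j; rewrite mxE; apply/eqP; rewrite -(sqrf_eq0 (v 0 j)).
  have pos i : 0 <= (Gam - mu i) * v 0 i ^+ 2.
    by rewrite mulr_ge0 ?sqr_ge0// subr_ge0 ltW.
  have /eqP : \sum_j (Gam - mu j) * v 0 j ^+ 2 = 0.
    by apply/eqP; rewrite eq_le h sumr_ge0.
  rewrite psumr_eq0// => /allP/(_ j); rewrite mem_index_enum => /(_ isT)/=.
  by rewrite mulf_eq0 subr_eq0 gt_eqF.
pose c := (\row_i f (z i)) *m invmx A.
have cz i : f (z i) = \sum_j c 0 j * u j (z i).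
  have : (c *m A) 0 i = f (z i) by rewrite mulmxKV// mxE.
  by rewrite mxE => <-; apply: eq_bigr => j _; rewrite [A _ _]mxE.
have := key _ _ _ Df cz.
have : \sum_j (Gam - mu j) * (2 * c 0 j * ip f (u j) - c 0 j ^+ 2) <=
       \sum_j (Gam - mu j) * ip f (u j) ^+ 2.
  apply: ler_sum => j _; apply: ler_wpM2l; first by rewrite subr_ge0 ltW.
  by rewrite -subr_ge0; have := sqr_ge0 (ip f (u j) - c 0 j); congr (0 <= _); ring.
set S1 := \sum_j _; set S2 := \sum_j _; lra.
Qed.

(** Ky Fan's trace inequality: by Bessel, the weights of the u j in the span of
    the f k are at most 1, and they are worth less than Gam. *)
Theorem trace_ge (f df : 'I_n -> R -> R) :
  (forall k, dirichlet_C1 (f k) (df k)) ->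
  (forall k l, ip (f k) (f l) = (k == l)%:R) ->
  \sum_j mu j <= \sum_k energy q (f k) (df k) (f k) (df k).
Proof.
move=> Df ipf.
have bessel j : \sum_k ip (f k) (u j) ^+ 2 <= 1.
  pose b k := ip (f k) (u j).
  have Dh := dirichlet_C1_comb b (Du j) Df.
  set h := fun x => u j x - \sum_k b k * f k x in Dh.
  have hf k : ip (f k) h = 0.
    rewrite ipC (ip_comb _ (Du j) (Df k) Df) (bigD1 k)//= ipf eqxx mulr1.
    rewrite big1 ?addr0 1?ipC ?subrr// => l lk; by rewrite ipf (negbTE lk) mulr0.
  have : 0 <= ip h h.
    have [ch _ _ _ _] := Dh.
    by apply: integ_ge0 => [|x _]; [exact: contM|rewrite -expr2 sqr_ge0].
  rewrite {1}/h (ip_comb _ (Du j) Dh Df).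
  under eq_bigr do rewrite hf mulr0.
  rewrite big1// subr0 ipC (ip_comb _ (Du j) (Du j) Df) ip_u eqxx subr_ge0.
  by under eq_bigr do rewrite /b -expr2.
have h1 : \sum_k (Gam * ip (f k) (f k) - \sum_j (Gam - mu j) * ip (f k) (u j) ^+ 2) <=
  \sum_k energy q (f k) (df k) (f k) (df k).
  by apply: ler_sum => k _; exact: energy_ge.
apply: le_trans h1; rewrite sumrB exchange_big/=.
under [X in _ <= X - _]eq_bigr do rewrite ipf eqxx mulr1.
rewrite -sumrB; apply: ler_sum => j _; rewrite -mulr_sumr.
rewrite lerBrDr -lerBrDl ler_piMr//.
by rewrite subr_ge0 ltW.
Qed.

End Trace.

(** * Smooth functions *)

Section SmoothFunctions.
Variable R : realType.
Implicit Types (f g F : R -> R) (x y a b c : R) (k n : nat).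

(** The derivatives of exp (- 1 / x), extended by 0, are combinations of the
    functions x ^- k * exp (- 1 / x). *)
Definition flat k x : R := if 0 < x then x ^- k * expR (- x^-1) else 0.

Lemma flat_ge0 k x : 0 <= flat k x.
Proof.
rewrite /flat; case: ifP => // x0; rewrite mulr_ge0 ?expR_ge0//.
by rewrite invr_ge0 exprn_ge0// ltW.
Qed.

Lemma flat_quadratic k x : `|flat k x| <= k.+2`!%:R * x ^+ 2.
Proof.
rewrite ger0_norm ?flat_ge0// /flat; case: ifP => x0; last first.
  by rewrite mulr_ge0// sqr_ge0.
have y0 : 0 <= x^-1 by rewrite invr_ge0 ltW.
have fact0 : 0 < k.+2`!%:R :> R by rewrite ltr0n fact_gt0.
have h : x^-1 ^+ k.+2 / k.+2`!%:R <= expR x^-1.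
  by apply: le_trans (expR_ge1Dxn k.+1 y0); rewrite lerDr.
rewrite expRN; have p : 0 < x^-1 ^+ k.+2 / k.+2`!%:R.
  by rewrite divr_gt0// exprn_gt0// invr_gt0.
have := lef_pV2 (expR_gt0 x^-1) p; rewrite h => h2.
apply: le_trans (ler_wpM2l _ h2) _; first by rewrite invr_ge0 exprn_ge0// ltW.
rewrite le_eqVlt; apply/orP; left; apply/eqP.
rewrite invfM invrK exprVn invrK -[k.+2]addn2 exprD.
have xk : x ^+ k != 0 by rewrite expf_neq0 ?gt_eqF.
rewrite addn2; field; exact: xk.
Qed.

Lemma deriv_quadratic f C : (forall x, `|f x| <= C * x ^+ 2) ->
  is_derive (0 : R) 1 f 0.
Proof.
move=> fC; have f0 : f 0 = 0.
  by apply/eqP; rewrite -normr_le0 (le_trans (fC 0))// expr0n mulr0.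
suff H : h^-1 *: (f (h *: 1 + 0) - f 0) @[h --> 0^'] --> (0:R).
  apply: DeriveDef; last exact: (cvg_lim _ H).
  by apply/cvg_ex; exists 0.
apply/cvgrPdist_lt => eps eps0.
have C0 : 0 <= C by have := fC 1; rewrite expr1n mulr1; apply: le_trans.
have d0 : 0 < eps / (C + 1) by rewrite divr_gt0// ltr_wpDl.
near=> h.
have h0 : h != 0 by near: h; exact: nbhs_dnbhs_neq.
rewrite sub0r normrN f0 subr0 addr0 /GRing.scale/= mulr1 normrM normfV.
rewrite mulrC ltr_pdivrMr ?normr_gt0//; apply: le_lt_trans (fC h) _.
rewrite -real_normK ?num_real// expr2 mulrA ltr_pM2r ?normr_gt0//.
have : `|h| < eps / (C + 1).
  by near: h; exact: dnbhs0_lt.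
rewrite ltr_pdivlMr ?ltr_wpDl// => /le_lt_trans; apply.
by rewrite mulrC ler_wpM2l// lerDl.
Unshelve. all: by end_near. Qed.

Lemma deriv_flat k x : is_derive x 1 (flat k) (flat k.+2 x - k%:R * flat k.+1 x).
Proof.
have [x0|x0|->] := ltgtP x 0.
- have -> : flat k.+2 x - k%:R * flat k.+1 x = 0.
    by rewrite /flat !(lt_gtF x0) mulr0 subr0.
  apply: (near_eq_is_derive _ (derivC 0 x)) => //; near=> y.
  rewrite /flat lt_gtF//; near: y; exact: lt_nbhsl.
- have xn : x != 0 by rewrite gt_eqF.
  have xkn : x ^+ k != 0 by rewrite expf_neq0.
  pose g y := (y ^+ k)^-1 * expR (- y^-1).
  have g1 : is_derive x 1 (fun y => y ^+ k) (k%:R * x ^+ k.-1).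
    have := is_deriveX k (deriv_id x); rewrite exprfctE => h.
    by apply: is_derive_eq h _; rewrite /GRing.scale/= mulr1.
  have g2 := deriv_comp (derivN (derivV xn (deriv_id x))) (is_derive_expR _).
  have gd := derivM (@derivV _ (fun y => y ^+ k) _ _ xkn g1) g2.
  apply: (near_eq_is_derive (f := g)) => //.
    near=> y; rewrite /flat ifT//; near: y; exact: lt_nbhsr.
  apply: is_derive_eq gd _; rewrite /flat x0.
  clear g1 g; case: k xkn => [|k] xkn.
    by rewrite !mul0r oppr0 !mul0r add0r expr0 invr1 mul1r; field.
  rewrite /= !exprS; field; rewrite xn/=.
  by move: xkn; rewrite exprS mulf_eq0 negb_or andbT => /andP[].
- have -> : flat k.+2 0 - k%:R * flat k.+1 0 = 0.
    by rewrite /flat ltxx mulr0 subr0.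
  exact: deriv_quadratic (flat_quadratic k).
Unshelve. all: by end_near. Qed.

(** A class of functions closed under differentiation: its members are smooth
    without any computation of higher derivatives. *)
Inductive elementary : (R -> R) -> Prop :=
| elementaryC c : elementary (fun=> c)
| elementaryD f g : elementary f -> elementary g ->
    elementary (fun x => f x + g x)
| elementaryM f g : elementary f -> elementary g ->
    elementary (fun x => f x * g x)
| elementary_flat k : elementary (flat k)
| elementary_affine f a b : elementary f -> elementary (fun x => f (a * x + b))
| elementary_primitive f F : elementary f ->
    (forall x, is_derive x 1 F (f x)) -> elementary F.

Lemma elementary_deriv f : elementary f ->
  exists2 df, elementary df & forall x, is_derive x 1 f (df x).
Proof.
elim=> {f} [c|f g _ [df ef fd] _ [dg eg gd]|f g ef [df edf fd] eg [dg edg gd]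
    |k|f a b _ [df edf fd]|f F ef _ Fd].
- by exists (fun=> 0); [exact: elementaryC|move=> x; exact: derivC].
- exists (fun x => df x + dg x); first exact: elementaryD.
  by move=> x; exact: (derivD (fd x) (gd x)).
- exists (fun x => df x * g x + f x * dg x).
    by apply: elementaryD; exact: elementaryM.
  by move=> x; exact: (derivM (fd x) (gd x)).
- exists (fun x => flat k.+2 x + (- k%:R) * flat k.+1 x).
    apply: elementaryD; first exact: elementary_flat.
    by apply: elementaryM; [exact: elementaryC|exact: elementary_flat].
  by move=> x; rewrite mulNr; exact: deriv_flat.
- exists (fun x => a * df (a * x + b)).
    by apply: elementaryM; [exact: elementaryC|exact: elementary_affine].
  move=> x; have h := derivD (derivZ a (deriv_id x)) (derivC b x).
  by apply: is_derive_eq (deriv_comp h (fd (a * x + b))) _; rewrite mulr1 addr0 mulrC.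
- by exists f.
Qed.

Lemma elementary_cont f : elementary f -> continuous f.
Proof. by move=> /elementary_deriv[df _]; exact: deriv_continuous. Qed.

Lemma elementary_smooth f : elementary f ->
  forall n x, derivable (derive1n n f) x 1.
Proof.
move=> ef n; suff : elementary (derive1n n f).
  by move=> /elementary_deriv[df _ h] x; have hx := h x; exact: ex_derive.
elim: n => [//|n IH]; rewrite derive1nS.
have [df edf h] := elementary_deriv IH.
have -> : (derive1n n f)^`()%classic = df; last exact: edf.
by apply/funext => x; rewrite derive1E; have [_ ->] := h x.
Qed.

(** The step is the normalised primitive of exp (- 1 / x) exp (- 1 / (1 - x)). *)
Lemma smooth_step : exists s ds : R -> R,
  [/\ elementary s, elementary ds,
     forall x, is_derive x 1 s (ds x),
     (forall x, x <= 0 -> s x = 0) /\ (forall x, 1 <= x -> s x = 1) &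
     forall x, 0 <= s x <= 1 /\ 0 <= ds x].
Proof.
pose beta x := flat 0 x * flat 0 (-1 * x + 1).
have eb : elementary beta.
  apply: elementaryM; first exact: elementary_flat.
  exact: (elementary_affine (-1) 1 (elementary_flat 0)).
have b0 x : 0 <= beta x by rewrite mulr_ge0// flat_ge0.
have bl x : x <= 0 -> beta x = 0 by move=> x0; rewrite /beta {1}/flat ltNge x0/= mul0r.
have br x : 1 <= x -> beta x = 0.
  move=> x1; rewrite /beta {2}/flat ltNge (_ : _ <= 0) ?mulr0//=; lra.
have bpos x : 0 < x < 1 -> 0 < beta x.
  move=> /andP[x0 x1]; have x1' : 0 < -1 * x + 1 by lra.
  by rewrite /beta /flat x0 x1' !expr0 !invr1 !mul1r mulr_gt0// expR_gt0.
have [F [F0 Fd]] := primitive (elementary_cont eb).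
have Fle a b : a <= b -> F a <= F b.
  by move=> ab; apply: (@deriv_ge0_le R F beta a b ab).
have F1 : 0 < F 1.
  have le13 : (1/4 : R) <= 3/4 by lra.
  have [c /andP[c1 c2] e] := mean_value le13 (fun x _ => Fd x).
  have : 0 < beta c by apply: bpos; apply/andP; split; lra.
  have h1 : F 0 <= F (1/4) by apply: Fle; lra.
  have h2 : F (3/4) <= F 1 by apply: Fle; lra.
  move: e h1 h2; rewrite F0; nra.
have Fl x : x <= 0 -> F x = 0.
  move=> x0; rewrite -F0; apply: (@deriv_0_const R F x 0 x0) => y /andP[_ y0].
  by apply: is_derive_eq (Fd y) _; exact: bl.
have Fr x : 1 <= x -> F x = F 1.
  move=> x1; symmetry; apply: (@deriv_0_const R F 1 x x1) => y /andP[y1 _].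
  by apply: is_derive_eq (Fd y) _; exact: br.
exists (fun x => (F 1)^-1 * F x), (fun x => (F 1)^-1 * beta x); split.
- by apply: elementaryM; [exact: elementaryC|exact: elementary_primitive eb Fd].
- by apply: elementaryM; [exact: elementaryC|].
- by move=> x; exact: (derivZ (F 1)^-1 (Fd x)).
- split=> x hx; first by rewrite (Fl x hx) mulr0.
  by rewrite (Fr x hx) mulVf// gt_eqF.
- have F1i : 0 <= (F 1)^-1 by rewrite invr_ge0 ltW.
  move=> x; split; last by rewrite mulr_ge0.
  have Fx0 : 0 <= F x.
    have [x0|/ltW x0] := leP x 0; first by rewrite (Fl x x0).
    by rewrite -F0 Fle.
  have FxF : F x <= F 1.
    have [x1|/ltW x1] := leP x 1; first exact: Fle.
    by rewrite (Fr x x1).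
  by rewrite mulr_ge0//= mulrC ler_pdivrMr// mul1r.
Qed.

End SmoothFunctions.

(** * Density of test functions *)

Section Density.
Variable R : realType.
Implicit Types (f g u du p : R -> R) (x y a b : R).

Lemma integ_cst (c : R) : integ (fun=> c) = c * pi.
Proof.
have h x (_ : 0 <= x <= pi) : is_derive x 1 (fun t => c * t) c.
  by apply: is_derive_eq (derivZ c (deriv_id x)) _; rewrite mulr1.
by rewrite (integ_deriv (@contC R c) h) mulr0 subr0.
Qed.

Lemma step_between a b : a < b -> exists s ds : R -> R,
  [/\ elementary s /\ elementary ds, forall x, is_derive x 1 s (ds x),
      forall x, x <= a -> s x = 0, forall x, b <= x -> s x = 1 &
      forall x, 0 <= s x <= 1 /\ 0 <= ds x].
Proof.
move=> ab; have [s [ds [es eds sd [sl sr] sI]]] := smooth_step R.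
have ba : 0 < b - a by rewrite subr_gt0.
pose c := (b - a)^-1; pose l x := c * x + - (c * a).
have c0 : 0 < c by rewrite invr_gt0.
have lE x : l x = (x - a) / (b - a) by rewrite /l /c; ring.
exists (fun x => s (l x)), (fun x => c * ds (l x)); split.
- split; first exact: elementary_affine.
  by apply: elementaryM; [exact: elementaryC|exact: elementary_affine].
- move=> x; have h := derivD (derivZ c (deriv_id x)) (derivC (- (c * a)) x).
  by apply: is_derive_eq (deriv_comp h (sd (l x))) _; rewrite mulr1 addr0 mulrC.
- by move=> x xa; apply: sl; rewrite lE pmulr_lle0 ?invr_gt0// subr_le0.
- by move=> x xb; apply: sr; rewrite lE ler_pdivlMr// mul1r lerD2r.
- move=> x; have [-> d0] := sI (l x); split=> //.
  by rewrite mulr_ge0// ltW.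
Qed.

(** Approximations on two overlapping intervals are glued by a smooth step;
    this exhausts the whole segment. *)
Lemma elementary_approx g b eps : continuous g -> 0 <= b -> 0 < eps ->
  exists2 p, elementary p & forall x, 0 <= x <= b -> `|p x - g x| <= eps.
Proof.
move=> cg b0 eps0.
pose S := [set t | 0 <= t <= b /\
  exists2 p, elementary p & forall x, 0 <= x <= t -> `|p x - g x| <= eps].
have S0 : S 0.
  split; first by rewrite lexx.
  exists (fun=> g 0); first exact: elementaryC.
  by move=> x; rewrite -eq_le => /eqP<-; rewrite subrr normr0 ltW.
have hS : has_sup S by split; [exists 0|exists b => t [/andP[]]].
set s := sup S.
have s0 : 0 <= s by apply: ub_le_sup => //; case: hS.
have sb : s <= b by apply: ge_sup; [exists 0|move=> t [/andP[]]].
have /cvgrPdist_le/(_ _ eps0)/nbhs_ballP[d/= d0 hd] := cg s.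
have d20 : 0 < d / 2 by rewrite divr_gt0.
have [t0 [/andP[t00 t0b] [p ep hp]] ht0] := sup_adherent d20 hS.
rewrite -/s in ht0.
have t0s : t0 <= s by apply: ub_le_sup => //; [case: hS|split; [exact/andP|exists p]].
have [k [dk [[ek _] _ kl kr kI]]] := step_between ht0.
pose p' x := p x * (1 + -1 * k x) + g s * k x.
have ep' : elementary p'.
  apply: elementaryD; apply: elementaryM => //; last exact: elementaryC.
  apply: elementaryD; first exact: elementaryC.
  by apply: elementaryM => //; exact: elementaryC.
have near_s x : s - d / 2 <= x <= s + d / 2 -> `|g s - g x| <= eps.
  move=> /andP[x1 x2]; apply: hd; rewrite /ball/= ltr_norml; lra.
have good x : 0 <= x <= s + d / 2 -> `|p' x - g x| <= eps.
  move=> /andP[x0 x1].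
  have [k01 _] := kI x; have /andP[k0 k1] := k01.
  have [xl|xl] := leP x (s - d / 2).
    rewrite /p' (kl x xl) !mulr0 !addr0 mulr1; apply: hp.
    by rewrite x0 (le_trans xl (ltW ht0)).
  have hs : `|g s - g x| <= eps by apply: near_s; rewrite (ltW xl) x1.
  have [xr|xr] := leP t0 x.
    by rewrite /p' (kr x xr) !mulr1 subrr mulr0 add0r.
  have hx : `|p x - g x| <= eps by apply: hp; rewrite x0 ltW.
  have -> : p' x - g x = (p x - g x) * (1 - k x) + (g s - g x) * k x.
    by rewrite /p'; ring.
  have k1' : 0 <= 1 - k x by rewrite subr_ge0.
  apply: le_trans (ler_normD _ _) _; rewrite !normrM (ger0_norm k0) (ger0_norm k1').
  have := ler_wpM2r k0 hs; have := ler_wpM2r k1' hx; lra.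
(* s + d / 2 exceeds the supremum s, so the whole segment is reached *)
pose t1 := Num.min b (s + d / 2).
have t1S : S t1.
  split.
    by rewrite /t1 le_min b0 ge_min lexx addr_ge0// ltW.
  exists p' => // x /andP[x0]; rewrite /t1 le_min => /andP[_ x1].
  by apply: good; rewrite x0.
have t1s : t1 <= s by apply: ub_le_sup => //; case: hS.
have t1b : t1 = b.
  move: t1s; rewrite /t1 ge_min => /orP[bs|]; last by lra.
  by apply/min_idPl; rewrite (le_trans bs)// lerDl ltW.
by case: t1S => _; rewrite t1b.
Qed.

Lemma cont_bounded f : continuous f ->
  exists2 M, 0 <= M & forall x, 0 <= x <= pi -> `|f x| <= M.
Proof.
move=> cf; have cn : continuous (fun x => `|f x|).
  by move=> x; apply: cvg_norm; exact: cf.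
have [c _ hc] := EVT_max (pi_ge0 R) (continuous_subspaceT cn).
by exists `|f c| => // x; have := hc x; rewrite in_itv.
Qed.

Lemma cutoff d : 0 < d -> exists k : R -> R,
  [/\ elementary k, forall x, 0 <= k x <= 1,
      forall x, x <= d / 2 -> k x = 0, forall x, pi - d / 2 <= x -> k x = 0 &
      d <= pi -> integ (fun x => 1 - k x) <= 2 * d].
Proof.
move=> d0.
have lk1 : d / 2 < d by lra.
have lk2 : pi - d < pi - d / 2 by lra.
have [k1 [dk1 [[ek1 _] _ k1l k1r k1I]]] := step_between lk1.
have [k2 [dk2 [[ek2 _] _ k2l k2r k2I]]] := step_between lk2.
have ck1 := elementary_cont ek1; have ck2 := elementary_cont ek2.
have c1 : continuous (fun x => 1 - k1 x) by apply: contB => //; exact: contC.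
pose k x := k1 x * (1 + -1 * k2 x).
have ek : elementary k.
  apply: elementaryM => //; apply: elementaryD; first exact: elementaryC.
  by apply: elementaryM => //; exact: elementaryC.
exists k; split=> // [x|x xd|x xd|dpi].
- have [/andP[a1 a2] _] := k1I x; have [/andP[b1 b2] _] := k2I x.
  have b3 : 0 <= 1 + -1 * k2 x by lra.
  rewrite /k mulr_ge0//= -[leRHS]mulr1 ler_pM//; lra.
- by rewrite /k k1l// mul0r.
- by rewrite /k k2r//; ring.
have I1 : integ (fun x => 1 - k1 x) <= d.
  have [F [F0 Fd]] := primitive c1.
  rewrite (integ_deriv c1 (fun x _ => Fd x)) F0 subr0.
  have -> : F pi = F d.
    symmetry; apply: (@deriv_0_const R F d pi) => [|x /andP[dx _]]; first by lra.
    by apply: is_derive_eq (Fd x) _; rewrite k1r// subrr.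
  have [x _] := mean_value (ltW d0) (fun x _ => Fd x).
  rewrite F0 !subr0 => ->; have [/andP[a1 a2] _] := k1I x.
  rewrite ler_piMl ?(ltW d0)//; lra.
have I2 : integ k2 <= d.
  have [F [F0 Fd]] := primitive ck2.
  rewrite (integ_deriv ck2 (fun x _ => Fd x)).
  have -> : F 0 = F (pi - d).
    apply: (@deriv_0_const R F 0 (pi - d)) => [|x /andP[_ dx]]; first by lra.
    by apply: is_derive_eq (Fd x) _; rewrite k2l.
  have le_d : pi - d <= pi by lra.
  have [x _ ->] := mean_value le_d (fun x _ => Fd x).
  have [/andP[a1 a2] _] := k2I x.
  have -> : pi - (pi - d) = d by ring.
  by rewrite ler_piMl ?(ltW d0).
apply: (@le_trans _ _ (integ (fun x => 1 - k1 x + k2 x))); last first.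
  rewrite integD//; lra.
apply: le_integ => [||x _].
- by apply: contB; [exact: contC|exact: elementary_cont].
- exact: contD.
have [/andP[a1 a2] _] := k1I x; have [/andP[b1 b2] _] := k2I x.
have : 0 <= k2 x * (1 - k1 x) by rewrite mulr_ge0// subr_ge0.
rewrite /k; lra.
Qed.

Lemma norm_le_integ_deriv g dg r : continuous r -> g 0 = 0 ->
  (forall x, 0 <= x <= pi -> is_derive x 1 g (dg x)) ->
  (forall x, 0 <= x <= pi -> `|dg x| <= r x) ->
  forall x, 0 <= x <= pi -> `|g x| <= integ r.
Proof.
move=> cr g0 gd dgr x /andP[x0 xpi]; have [V [V0 Vd]] := primitive cr.
have -> : integ r = V pi by rewrite (integ_deriv cr (fun x _ => Vd x)) V0 subr0.
apply: (@le_trans _ _ (V x)); last first.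
  apply: (@deriv_ge0_le R V r x pi xpi) => // y /andP[xy ypi].
  by apply: le_trans (normr_ge0 _) (dgr y _); rewrite ypi (le_trans x0).
have main (sg : R) : `|sg| = 1 -> sg * g x <= V x.
  move=> sg1; rewrite -subr_ge0.
  have -> : 0 = V 0 - sg * g 0 by rewrite V0 g0 mulr0 subrr.
  have yI y : 0 <= y <= x -> 0 <= y <= pi by move=> /andP[-> /le_trans->].
  apply: (@deriv_ge0_le R (fun x => V x - sg * g x)
    (fun x => r x - sg * dg x) 0 x x0).
    by move=> y /yI ypi; exact: (derivB (Vd y) (derivZ sg (gd y ypi))).
  move=> y /yI ypi; rewrite subr_ge0; apply: le_trans (dgr y ypi).
  by rewrite -[leRHS]mul1r -sg1 -normrM ler_norm.
have h1 := main 1 (normr1 _); have := main (-1).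
rewrite normrN normr1 => /(_ erefl); rewrite ler_norml; lra.
Qed.

(** The truncation f k has compact support in the open interval, but its mean
    W pi need not vanish; subtracting W pi times the bump ds, of mean 1, gives the
    derivative of a test function. *)
Lemma test_function_of_derivative f k s ds d : elementary f ->
  elementary s -> elementary ds -> 0 < d -> d <= pi / 4 ->
  (forall x, is_derive x 1 s (ds x)) ->
  (forall x, x <= pi / 4 -> s x = 0) -> (forall x, pi * 3 / 4 <= x -> s x = 1) ->
  elementary k ->
  (forall x, x <= d / 2 -> k x = 0) -> (forall x, pi - d / 2 <= x -> k x = 0) ->
  exists W phi : R -> R,
  [/\ W 0 = 0, forall x, is_derive x 1 W (f x * k x),
      test_function phi, phi 0 = 0 &
      forall x, is_derive x 1 phi (f x * k x - W pi * ds x)].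
Proof.
move=> ef es eds d0 d1 sd sl sr ek kl kr.
have efk : elementary (fun x => f x * k x) by exact: elementaryM.
have [W [W0 Wd]] := primitive (elementary_cont efk).
have eW := elementary_primitive efk Wd.
pose phi x := W x + - W pi * s x.
have ephi : elementary phi.
  by apply: elementaryD => //; apply: elementaryM => //; exact: elementaryC.
have pi0 := pi_gt0 R.
have s0 : s 0 = 0 by apply: sl; lra.
have flat_l y : y <= d / 2 -> is_derive y 1 W 0.
  by move=> yd; apply: is_derive_eq (Wd y) _; rewrite kl// mulr0.
have flat_r y : pi - d / 2 <= y -> is_derive y 1 W 0.
  by move=> yd; apply: is_derive_eq (Wd y) _; rewrite kr// mulr0.
have dl : 0 <= d / 2 by lra.
have dr : pi - d / 2 <= pi by lra.
have lr : d / 2 <= pi / 4 /\ pi * 3 / 4 <= pi - d / 2 by split; lra.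
have KI x : d / 2 <= x <= pi - d / 2 -> 0 < x < pi.
  by move=> /andP[? ?]; apply/andP; split; lra.
exists W, phi; split=> //; last 2 first.
- by rewrite /phi W0 s0 mulr0 addr0.
- move=> x; rewrite -mulNr; exact: (derivD (Wd x) (derivZ (- W pi) (sd x))).
split; first exact: elementary_smooth.
exists `[d / 2, pi - d / 2]%classic; split.
- exact: segment_compact.
- by move=> x; rewrite /Ipi/= !in_itv/=; exact: KI.
clear KI ephi efk ef es eds ek d0 d1 pi0 s0; case: lr => l4 r4.
move=> x /negP; rewrite /= in_itv/= negb_and -!ltNge => /orP[/ltW xl|/ltW xr].
  rewrite /phi (sl x (le_trans xl l4)) mulr0 addr0 -W0.
  have [x0|/ltW x0] := leP x 0.
    by apply: deriv_0_const x0 _ => y /andP[_ y0]; apply: flat_l; exact: le_trans y0 dl.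
  symmetry; apply: deriv_0_const x0 _ => y /andP[_ yx]; apply: flat_l.
  exact: le_trans yx xl.
rewrite /phi (sr x (le_trans r4 xr)) mulr1.
apply/eqP; rewrite subr_eq0; apply/eqP.
have [x0|/ltW x0] := leP x pi.
  by apply: deriv_0_const x0 _ => y /andP[xy _]; apply: flat_r; exact: le_trans xr xy.
symmetry; apply: deriv_0_const x0 _ => y /andP[ypi _]; apply: flat_r.
exact: le_trans dr ypi.
Qed.

(** If phi' = p k - c s' with p within e of u' and k a cut-off, then phi' - u' is
    bounded, and its integral is small with e; this bounds the H^1 distance. *)
Lemma test_function_approx u du eps : dirichlet_C1 u du -> 0 < eps ->
  exists phi dphi, [/\ test_function phi,
    forall x, is_derive x 1 phi (dphi x), continuous dphi &
    integ (fun x => (phi x - u x) ^+ 2 + (dphi x - du x) ^+ 2) <= eps].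
Proof.
move=> [cu cdu ud u0 upi] eps0; have pi0 := pi_gt0 R.
have l13 : pi / 4 < pi * 3 / 4 :> R by lra.
have [s [ds [[es eds] sd sl sr sI]]] := step_between l13.
have s0 : s 0 = 0 by apply: sl; lra.
have spi : s pi = 1 by apply: sr; lra.
have cds := elementary_cont eds.
have [Bm Bm0 hBm] := cont_bounded cds; have [U U0 hU] := cont_bounded cdu.
(* with p within e of u' and a cut-off of width d <= e / U, the distance in L^1 of
   p k to u' is at most e K; C bounds phi' - u', and the final bound is e T *)
pose K : R := pi + 2; pose C := 1 + U + K * Bm.
have K0 : 0 < K by rewrite /K; lra.
have C0 : 0 < C by rewrite /C; have := mulr_ge0 (ltW K0) Bm0; lra.
pose T := K * (4 * pi * K + 2 * C).
have T0 : 0 < T by rewrite mulr_gt0// addr_gt0 ?mulr_gt0.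
pose e := Num.min 1 (eps / T).
have e0 : 0 < e by rewrite lt_min ltr01 divr_gt0.
have e1 : e <= 1 by rewrite ge_min lexx.
have eT : e * T <= eps by rewrite -ler_pdivlMr// ge_min lexx orbT.
pose d := Num.min (pi / 4) (e / (U + 1)).
have U1 : 0 < U + 1 by lra.
have d0 : 0 < d by rewrite lt_min !divr_gt0.
have d1 : d <= pi / 4 by rewrite ge_min lexx.
have dU : d * U <= e.
  apply: (@le_trans _ _ (d * (U + 1))); first by rewrite ler_wpM2l ?ltW// ltrDl.
  by rewrite -ler_pdivlMr// ge_min lexx orbT.
clearbody e d.
have [p ep hp] := elementary_approx cdu (ltW pi0) e0.
have [k [ek kI kl kr Ik]] := cutoff d0.
have {}Ik : integ (fun x => 1 - k x) <= 2 * d by apply: Ik; lra.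
have [W [phi [W0 Wd tphi phi0 phid]]] :=
  test_function_of_derivative ep es eds d0 d1 sd sl sr ek kl kr.
clear kl kr d1 d0 sl sr es eds eps0 l13.
have cphi : continuous phi by exact: deriv_continuous phid.
have ck := elementary_cont ek.
have cpk : continuous (fun x => p x * k x).
  by apply: contM => //; exact: elementary_cont.
pose c := W pi; pose dphi x := p x * k x - c * ds x.
have ccds (b : R) : continuous (fun x => b * ds x).
  by apply: contM => //; exact: contC.
have cdphi : continuous dphi by exact: contB.
pose r0 x := e + U * (1 - k x).
have c1k : continuous (fun x => 1 - k x) by apply: contB => //; exact: contC.
have cU : continuous (fun x => U * (1 - k x)) by apply: contM => //; exact: contC.
have cr0 : continuous r0 by apply: contD => //; exact: contC.
have Ir0 : integ r0 <= e * K.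
  rewrite /r0 integD//; last exact: contC.
  rewrite integ_cst integZ//; have := ler_wpM2l U0 Ik; rewrite /K; lra.
have r0_ge x : 0 <= x <= pi -> `|p x * k x - du x| <= r0 x.
  move=> xpi; have /andP[kx0 kx1] := kI x.
  have -> : p x * k x - du x = (p x - du x) * k x - du x * (1 - k x) by ring.
  apply: le_trans (ler_normB _ _) _; rewrite normrM [`|du x * _|]normrM (ger0_norm kx0).
  have kx1' : 0 <= 1 - k x by rewrite subr_ge0.
  rewrite (ger0_norm kx1') /r0; apply: lerD.
    by rewrite -[leRHS]mulr1 ler_pM// hp.
  by rewrite ler_pM// hU.
have pipi : 0 <= (pi : R) <= pi by rewrite lexx ltW.
have cE : `|c| <= e * K.
  apply: le_trans Ir0; rewrite -[c]subr0 -upi.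
  apply: (norm_le_integ_deriv (g := fun x => W x - u x)
    (dg := fun x => p x * k x - du x) cr0 _ _ r0_ge) => //.
    by rewrite W0 u0 subrr.
  by move=> x xpi; exact: (derivB (Wd x) (ud x xpi)).
pose r x := r0 x + `|c| * ds x.
have cr : continuous r by exact: contD.
have Ir : integ r <= 2 * (e * K).
  rewrite integD// integZ// (integ_deriv cds (fun x _ => sd x)) s0 spi subr0 mulr1.
  by rewrite mulr_natl mulr2n lerD.
have r_ge x : 0 <= x <= pi -> `|dphi x - du x| <= r x.
  move=> xpi; have -> : dphi x - du x = (p x * k x - du x) + - c * ds x.
    by rewrite /dphi; ring.
  apply: le_trans (ler_normD _ _) _; apply: lerD; first exact: r0_ge.
  by have [_ ds0] := sI x; rewrite normrM normrN (ger0_norm ds0).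
have sup_bound x : 0 <= x <= pi -> `|phi x - u x| <= 2 * (e * K).
  move=> xpi; apply: le_trans Ir.
  apply: (norm_le_integ_deriv (g := fun x => phi x - u x)
    (dg := fun x => dphi x - du x) cr _ _ r_ge) => //.
    by rewrite phi0 u0 subrr.
  by move=> y ypi; exact: (derivB (phid y) (ud y ypi)).
have eK0 : 0 <= e * K by rewrite mulr_ge0 ?ltW.
have r_le x : 0 <= x <= pi -> r x <= C.
  move=> xpi; rewrite /r /r0 /C; apply: lerD.
    apply: lerD => //; rewrite ler_piMr// gerBl.
    by have /andP[] := kI x.
  rewrite ler_pM//; first by have [] := sI x.
    by apply: le_trans cE _; rewrite ler_piMl ?(ltW K0).
  by apply: le_trans (hBm x xpi); exact: ler_norm.
exists phi, dphi; split=> //.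
have cint : continuous (fun x => (phi x - u x) ^+ 2 + (dphi x - du x) ^+ 2).
  by apply: contD; apply: contX; exact: contB.
have cCr : continuous (fun x => C * r x) by apply: contM => //; exact: contC.
apply: (@le_trans _ _ (integ (fun x => (2 * (e * K)) ^+ 2 + C * r x))).
  apply: le_integ => //; first by apply: contD => //; exact: contC.
  move=> x xpi; apply: lerD.
    have n := sup_bound x xpi; rewrite -[leLHS]real_normK ?num_real//.
    by rewrite ler_pXn2r// ?nnegrE// mulr_ge0.
  rewrite -[leLHS]real_normK ?num_real// expr2.
  have h1 := r_ge x xpi; have h2 := le_trans h1 (r_le x xpi).
  by rewrite ler_pM.
apply: le_trans eT; rewrite integD//; last exact: contC.
rewrite integ_cst integZ//.
have h1 := ler_wpM2l (ltW C0) Ir.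
have h2 : (2 * (e * K)) ^+ 2 * pi <= e * (K * (4 * pi * K)).
  have -> : (2 * (e * K)) ^+ 2 * pi = e * (e * (K * (4 * pi * K))) by ring.
  rewrite ler_wpM2l ?(ltW e0)// ler_piMl//.
  by rewrite !mulr_ge0// ltW.
have -> : e * T = e * (K * (4 * pi * K)) + C * (2 * (e * K)) by rewrite /T; ring.
exact: lerD.
Qed.

End Density.

(** * Classical eigenfunctions are weak eigenfunctions *)

Section WeakEigenspace.
Variable R : realType.
Implicit Types (f g u du v dv phi q : R -> R) (mu : R).
Local Notation leb := (@lebesgue_measure R).

Lemma measurable_Ipi : measurable (Ipi R : set (measurableTypeR R)).
Proof. exact: measurable_itv. Qed.

Lemma cont_measurable_Ipi f : continuous f -> measurable_fun (Ipi R) f.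
Proof.
by move=> cf; apply: measurable_funTS; exact: continuous_measurable_fun.
Qed.

Lemma cont_integrable_Ipi f : continuous f -> leb.-integrable (Ipi R) (EFin \o f).
Proof.
move=> cf; have := cont_integrable 0 pi cf; apply: integrableS.
- exact: measurable_itv.
- exact: measurable_itv.
- exact: subset_itv_oo_cc.
Qed.

Lemma integrable_IpiD f g : leb.-integrable (Ipi R) (EFin \o f) ->
  leb.-integrable (Ipi R) (EFin \o g) ->
  leb.-integrable (Ipi R) (EFin \o (fun x => f x + g x)).
Proof.
move=> fi gi; have mI := measurable_Ipi.
apply: (eq_integrable mI _ _ _ (integrableD mI fi gi)).
by move=> x _; rewrite /= EFinD.
Qed.

Lemma integrable_IpiZ (c : R) f : leb.-integrable (Ipi R) (EFin \o f) ->
  leb.-integrable (Ipi R) (EFin \o (fun x => c * f x)).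
Proof.
move=> fi; have mI := measurable_Ipi.
apply: (eq_integrable mI _ _ _ (integrableZl mI c fi)).
by move=> x _; rewrite /= EFinM.
Qed.

Lemma integrable_IpiB f g : leb.-integrable (Ipi R) (EFin \o f) ->
  leb.-integrable (Ipi R) (EFin \o g) ->
  leb.-integrable (Ipi R) (EFin \o (fun x => f x - g x)).
Proof.
move=> fi gi; have igN := integrable_IpiZ (-1) gi.
apply: (eq_integrable measurable_Ipi _ _ _ (integrable_IpiD fi igN)).
by move=> x _; rewrite /= mulN1r.
Qed.

Lemma Rintegral_Ipi f : continuous f -> \int[leb]_(x in Ipi R) f x = integ f.
Proof.
move=> cf; rewrite /integ /Rintegral; congr fine; symmetry.
by apply: integral_itv_bndoo; apply/measurable_EFinP; exact: cont_measurable_Ipi.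
Qed.

Lemma integral_Ipi f : continuous f ->
  (\int[leb]_(x in Ipi R) (f x)%:E = (integ f)%:E)%E.
Proof.
move=> cf; rewrite -Rintegral_Ipi// /Rintegral fineK//.
by apply: integrable_fin_num; [exact: measurable_Ipi|exact: cont_integrable_Ipi].
Qed.

Lemma eq_Rintegral_Ipi f g : (forall x, 0 < x < pi -> f x = g x) ->
  \int[leb]_(x in Ipi R) f x = \int[leb]_(x in Ipi R) g x.
Proof.
by move=> fg; apply: eq_Rintegral => x; rewrite inE /Ipi/= in_itv/= => /fg.
Qed.

Lemma cont_L2 f : continuous f -> L2 f.
Proof.
move=> cf; split; first exact: cont_measurable_Ipi.
by rewrite integral_Ipi ?ltry//; exact: contX.
Qed.

(** The interval being bounded, |f v| <= M (1 + v ^ 2) is integrable. *)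
Lemma L2_integrable_mul f v : continuous f -> L2 v ->
  leb.-integrable (Ipi R) (EFin \o (fun x => f x * v x)).
Proof.
move=> cf [mv v2]; have [M M0 hM] := cont_bounded cf.
have mI := measurable_Ipi.
have iv2 : leb.-integrable (Ipi R) (EFin \o (fun x => v x ^+ 2)).
  apply/integrableP; split.
    by apply/measurable_EFinP; exact: measurable_funX.
  move: v2; under eq_integral do rewrite -[in X in X%:E](ger0_norm (sqr_ge0 _)).
  by [].
have ib : leb.-integrable (Ipi R) (EFin \o (fun x => M * (1 + v x ^+ 2))).
  have i1 := cont_integrable_Ipi (@contC R 1).
  exact: (integrable_IpiZ M (integrable_IpiD i1 iv2)).
apply: le_integrable ib => //.
  by apply/measurable_EFinP; apply: measurable_funM => //; exact: cont_measurable_Ipi.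
move=> x; rewrite /Ipi/= in_itv/= => /andP[x0 xpi]; rewrite lee_fin.
have v0 : 0 <= 1 + v x ^+ 2 by rewrite addr_ge0// sqr_ge0.
rewrite [leRHS]ger0_norm ?mulr_ge0// normrM ler_pM//.
  by apply: hM; rewrite !ltW.
rewrite -[v x ^+ 2]real_normK ?num_real//.
by have := sqr_ge0 (1 - `|v x|); nra.
Qed.

Lemma test_function_C1 phi : test_function phi ->
  [/\ continuous phi, continuous (derive1 phi),
      forall x : R, is_derive x 1 phi (derive1 phi x), phi 0 = 0 & phi pi = 0].
Proof.
move=> [sm [K [cK KI Kz]]].
have d0 (x : R) : is_derive x 1 phi (derive1 phi x).
  by rewrite derive1E; apply: derivableP; exact: (sm 0%N x).
have d1 (x : R) : is_derive x 1 (derive1 phi) (derive1 (derive1 phi) x).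
  by rewrite derive1E; apply: derivableP; exact: (sm 1%N x).
split=> //; [exact: deriv_continuous d0|exact: deriv_continuous d1| |];
  by apply: Kz => /KI; rewrite /Ipi/= in_itv/= ltxx ?andbF.
Qed.

Lemma dirichlet_C1_H10 u du : dirichlet_C1 u du -> H10 u du.
Proof.
move=> Du; have [cu cdu ud u0 upi] := Du; split.
- exact: cont_L2.
- exact: cont_L2.
- move=> phi /test_function_C1[cp cdp pd p0 ppi].
  rewrite !Rintegral_Ipi; [|exact: contM..].
  apply/eqP; rewrite -subr_eq0 opprK -integD; [|exact: contM..].
  have h x : 0 <= x <= pi -> is_derive x 1 (fun x => u x * phi x)
      (u x * derive1 phi x + du x * phi x).
    by move=> xpi; apply: is_derive_eq (derivM (ud x xpi) (pd x)) _; rewrite addrC.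
  rewrite (integ_deriv _ h) ?u0 ?upi ?mul0r ?subrr//.
  by apply: contD; exact: contM.
- have /choice[phi Hphi] : forall n : nat, exists phi, test_function phi /\
      integ (fun x => (phi x - u x) ^+ 2 + (derive1 phi x - du x) ^+ 2) <= n.+1%:R^-1.
    move=> n; have n0 : 0 < n.+1%:R^-1 :> R by rewrite invr_gt0 ltr0n.
    have [phi [dphi [tphi pd _ h]]] := test_function_approx Du n0.
    exists phi; split=> //; apply: le_trans h.
    rewrite le_eqVlt; apply/orP; left; apply/eqP; apply: integ_ext => x _.
    by rewrite derive1E; have [_ ->] := pd x.
  exists phi; split; first by move=> n; have [] := Hphi n.
  have cint n : continuous
      (fun x => (phi n x - u x) ^+ 2 + (derive1 (phi n) x - du x) ^+ 2).
    have [/test_function_C1[c1 c2 _ _ _] _] := Hphi n.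
    by apply: contD; apply: contX; exact: contB.
  under eq_fun do rewrite integral_Ipi//.
  apply: cvg_EFin; first exact: nearW.
  apply: (@squeeze_cvgr _ _ _ _ (fun=> 0) (fun n => n.+1%:R^-1)).
  + near=> n; apply/andP; split; last by have [] := Hphi n.
    by apply: integ_ge0 => // x _; rewrite addr_ge0// sqr_ge0.
  + exact: cvg_cst.
  + exact: cvg_harmonic.
Unshelve. all: by end_near. Qed.

(** For a test function in place of v the integrand is the derivative of f v.  The
    left-hand side is continuous for the H^1 norm, by |x| <= d / 2 + x ^ 2 / (2 d)
    in place of the inequality of Cauchy and Schwarz. *)
Lemma H10_by_parts f g v dv : continuous f -> continuous g ->
  (forall x, 0 <= x <= pi -> is_derive x 1 f (g x)) -> H10 v dv ->
  \int[leb]_(x in Ipi R) (f x * dv x + g x * v x) = 0.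
Proof.
move=> cf cg fd [L2v L2dv _ [phi [tphi lphi]]].
have mI := measurable_Ipi.
have [M1 M10 hM1] := cont_bounded cf; have [M2 M20 hM2] := cont_bounded cg.
pose M := M1 + M2; have M0 : 0 <= M by rewrite addr_ge0.
have ifv : leb.-integrable (Ipi R) (EFin \o (fun x => f x * dv x + g x * v x)).
  exact: (integrable_IpiD (L2_integrable_mul cf L2dv) (L2_integrable_mul cg L2v)).
apply/eqP; rewrite -normr_le0; apply/ler_addgt0Pr => eta eta0; rewrite add0r.
have pi0 := pi_gt0 R.
pose d := eta / (M * (pi + 1) + 1).
have den0 : 0 < M * (pi + 1) + 1 by rewrite ltr_wpDl// mulr_ge0// addr_ge0// ltW.
have d0 : 0 < d by rewrite divr_gt0.
have dE : M * d * (pi + 1) <= eta.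
  have e : eta = d * (M * (pi + 1) + 1) by rewrite /d divfK// gt_eqF.
  by rewrite e; nra.
have [n _ hn] : \forall n \near \oo, (\int[leb]_(x in Ipi R)
   ((phi n x - v x) ^+ 2 + (derive1 (phi n) x - dv x) ^+ 2)%:E <= (d ^+ 2)%:E)%E.
  have e2 : (0 < (d ^+ 2)%:E)%E by rewrite lte_fin exprn_gt0.
  have := lphi _ (open_ereal_lt' e2) => -[N _ hN]; exists N => // k kN.
  by apply: ltW; exact: hN.
have {hn} := hn n (leqnn n).
have [cp cdp pd p0 ppi] := test_function_C1 (tphi n).
move: (phi n) cp cdp pd p0 ppi => p cp cdp pd p0 ppi {phi tphi lphi}.
set D := fun x => (p x - v x) ^+ 2 + (derive1 p x - dv x) ^+ 2 => hD.
have mD : measurable_fun (Ipi R) D.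
  have [mv _] := L2v; have [mdv _] := L2dv.
  by apply: measurable_funD; apply: measurable_funX; apply: measurable_funB => //;
    exact: cont_measurable_Ipi.
have Dge0 x : 0 <= D x by rewrite addr_ge0// sqr_ge0.
have iD : leb.-integrable (Ipi R) (EFin \o D).
  apply/integrableP; split; first exact/measurable_EFinP.
  under eq_integral do rewrite /= ger0_norm//.
  exact: le_lt_trans hD (ltry _).
have ID : \int[leb]_(x in Ipi R) D x <= d ^+ 2.
  rewrite -lee_fin /Rintegral fineK//.
  by have := integrable_fin_num mI iD.
have zero : \int[leb]_(x in Ipi R) (f x * derive1 p x + g x * p x) = 0.
  rewrite Rintegral_Ipi; last by apply: contD; exact: contM.
  have h x : 0 <= x <= pi -> is_derive x 1 (fun x => f x * p x)
      (f x * derive1 p x + g x * p x).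
    by move=> xpi; apply: is_derive_eq (derivM (fd x xpi) (pd x)) _; rewrite addrC.
  rewrite (integ_deriv _ h) ?p0 ?ppi ?mulr0 ?subrr//.
  by apply: contD; exact: contM.
have ifp : leb.-integrable (Ipi R) (EFin \o (fun x => f x * derive1 p x + g x * p x)).
  by apply: cont_integrable_Ipi; apply: contD; exact: contM.
rewrite -[X in `|X|]subr0 -zero -RintegralB//.
apply: le_trans (le_normr_Rintegral mI _) _.
  exact: (integrable_IpiB ifv ifp).
apply: (@le_trans _ _ (\int[leb]_(x in Ipi R) (M * d + M / (2 * d) * D x))).
  have iR : leb.-integrable (Ipi R) (EFin \o (fun x => M * d + M / (2 * d) * D x)).
    have i1 := cont_integrable_Ipi (@contC R (M * d)).
    exact: (integrable_IpiD i1 (integrable_IpiZ _ iD)).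
  apply: le_Rintegral => //.
    exact: (integrable_abse (integrable_IpiB ifv ifp)).
  move=> x; rewrite /Ipi/= in_itv/= => /andP[x0 xpi].
  have xI : 0 <= x <= pi by rewrite !ltW.
  have -> : f x * dv x + g x * v x - (f x * derive1 p x + g x * p x) =
    - (f x * (derive1 p x - dv x)) - g x * (p x - v x) by ring.
  apply: le_trans (ler_normB _ _) _; rewrite normrN !normrM.
  have young (a : R) : `|a| <= d / 2 + a ^+ 2 / (2 * d).
    rewrite -[a ^+ 2]real_normK ?num_real//.
    have -> : d / 2 + `|a| ^+ 2 / (2 * d) = (d ^+ 2 + `|a| ^+ 2) / (2 * d).
      by field; rewrite gt_eqF.
    have d2 : 0 < 2 * d by rewrite pmulr_rgt0.
    rewrite ler_pdivlMr//.
    by have := sqr_ge0 (d - `|a|); nra.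
  have fM : `|f x| <= M by apply: le_trans (hM1 x xI) _; rewrite lerDl.
  have gM : `|g x| <= M by apply: le_trans (hM2 x xI) _; rewrite lerDr.
  have h1 := ler_pM (normr_ge0 _) (normr_ge0 _) fM (young (derive1 p x - dv x)).
  have h2 := ler_pM (normr_ge0 _) (normr_ge0 _) gM (young (p x - v x)).
  apply: le_trans (lerD h1 h2) _; rewrite /D.
  rewrite le_eqVlt; apply/orP; left; apply/eqP; field; by rewrite gt_eqF.
rewrite RintegralD//; last 2 first.
- exact: (cont_integrable_Ipi (@contC R (M * d))).
- exact: (integrable_IpiZ (M / (2 * d)) iD).
have ec : \int[leb]_(x in Ipi R) (M * d) = M * d * pi.
  exact: (etrans (Rintegral_Ipi (@contC R (M * d))) (integ_cst _)).
rewrite ec RintegralZl//.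
have c0 : 0 <= M / (2 * d) by rewrite divr_ge0// mulr_ge0// ltW.
apply: le_trans (lerD (lexx _) (ler_wpM2l c0 ID)) _; apply: le_trans dE.
have -> : M / (2 * d) * d ^+ 2 = M * d / 2 by field; rewrite gt_eqF.
by have := mulr_ge0 M0 (ltW d0); lra.
Qed.

Lemma eigenfunction_eigenspace q qc mu u du : continuous qc ->
  (forall x, 0 <= x <= pi -> q x = qc x) -> eigenfunction qc mu u du ->
  dirichlet_eigenspace q mu u.
Proof.
move=> cqc qE [Du dud _]; have [cu cdu _ _ _] := Du.
exists du; first exact: dirichlet_C1_H10.
move=> v dv Hv; have [L2v L2dv _ _] := Hv; have mI := measurable_Ipi.
have cg : continuous (fun x => (qc x - mu) * u x).
  by apply: contM => //; apply: contB => //; exact: contC.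
have := H10_by_parts cdu cg dud Hv.
have -> : \int[leb]_(x in Ipi R) (du x * dv x + (qc x - mu) * u x * v x) =
    \int[leb]_(x in Ipi R) ((du x * dv x + qc x * u x * v x) - mu * (u x * v x)).
  by apply: eq_Rintegral => x _; ring.
have iuv : leb.-integrable (Ipi R) (EFin \o (fun x => u x * v x)).
  exact: L2_integrable_mul.
rewrite RintegralB//; last 2 first.
- have i1 := L2_integrable_mul cdu L2dv.
  have i2 := L2_integrable_mul (contM cqc cu) L2v.
  exact: (integrable_IpiD i1 i2).
- exact: (integrable_IpiZ mu iuv).
rewrite RintegralZl// => /eqP; rewrite subr_eq0 => /eqP <-.
by apply: eq_Rintegral_Ipi => x /andP[x0 xpi]; rewrite qE// !ltW.
Qed.

(** Were mu absent from the list, its eigenspace would have dimension 0, whereas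
    it contains the normalised function u. *)
Lemma eigenvalue_listed q qc (lam : nat -> R) mu u du : continuous qc ->
  (forall x, 0 <= x <= pi -> q x = qc x) -> dirichlet_eigenvalues q lam ->
  eigenfunction qc mu u du -> exists2 k, (0 < k)%N & lam k = mu.
Proof.
move=> cqc qE [_ Hlam] Eu; have Wu := eigenfunction_eigenspace cqc qE Eu.
have [[cu _ _ _ _] _ uu] := Eu; have mI := measurable_Ipi.
apply: contrapT => nk.
have [_ [|f [_ _ /(_ u Wu)[c ae0]]]] := Hlam mu 0%N.
  have -> : [set k : nat | (1 <= k)%N /\ lam k = mu] = set0.
    by apply/seteqP; split => // k [k1 ke]; apply: nk; exists k.
  by rewrite II0.
have : (\int[leb]_(x in Ipi R) (u x * u x)%:E = \int[leb]_(x in Ipi R) (cst 0 x))%E.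
  apply: ae_eq_integral => //.
    by apply/measurable_EFinP; apply: cont_measurable_Ipi; exact: contM.
  have FF := ae_filter_ringOfSetsType leb.
  apply: filterS ae0 => x + xI => /(_ xI) ->.
  by rewrite big_ord0 mulr0.
rewrite integral_Ipi; last exact: contM.
by rewrite integral0 -/(ip u u) uu => /eqP; rewrite eqe oner_eq0.
Qed.

End WeakEigenspace.

(** * The lowest eigenvalues, and sines as trial functions *)

Section LowEigenvalues.
Variable R : realType.
Implicit Types (q qc : R -> R).

(** The angles are scaled by n + 1, the largest multiple of pi to be attained: mu
    (n + 1) serves as the level Gam of the trace inequality. *)
Lemma low_eigenvalues q n : continuous q -> (exists M, forall x, `|q x| <= M) ->
  exists mu : nat -> R,
  [/\ forall k, (0 < k <= n)%N -> exists u du, eigenfunction q (mu k) u du,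
      forall k, (0 < k < n)%N -> mu k < mu k.+1 &
      forall f df : 'I_n -> R -> R, (forall k, dirichlet_C1 (f k) (df k)) ->
        (forall k l, ip (f k) (f l) = (k == l)%:R) ->
        \sum_(k < n) mu k.+1 <= \sum_k energy q (f k) (df k) (f k) (df k)].
Proof.
move=> cq bq; have [M qM] := bq.
have [mu [psi [Hpsi muS]]] := pruefer_energies n.+1 cq qM.
have m0 : 0 < n.+1%:R :> R by rewrite ltr0n.
have Eu k : (0 < k <= n.+1)%N -> exists u du, eigenfunction q (mu k) u du.
  by move=> /Hpsi[Hp Hpi]; exact: (eigenfunction_exists cq m0 Hp Hpi).
have mu_lt i j : (0 < i)%N -> (i < j)%N -> (j <= n.+1)%N -> mu i < mu j.
  move=> i0; elim: j => [//|j IH]; rewrite ltnS leq_eqVlt => /predU1P[<-|ij] jn.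
    by apply: muS; rewrite i0.
  by apply: lt_trans (IH ij (ltnW jn)) _; apply: muS; rewrite (leq_trans i0 (ltnW ij)).
exists mu; split=> [k /andP[k0 kn]|k /andP[k0 kn]|f df Df ipf].
- by apply: Eu; rewrite k0 ltnW.
- by apply: muS; rewrite k0 ltnW.
have /choice[u /choice[du Hu]] : forall j : 'I_n,
    exists u du, eigenfunction q (mu j.+1) u du.
  by move=> j; apply: Eu; rewrite /= ltnS ltnW.
have mu_inj : injective (fun j : 'I_n => mu j.+1).
  move=> i j /= e; apply/val_inj => /=; have [ij|ji|//] := ltngtP i j.
    by have := mu_lt i.+1 j.+1 isT ij (ltnW (ltn_ord j)); rewrite e ltxx.
  by have := mu_lt j.+1 i.+1 isT ji (ltnW (ltn_ord i)); rewrite e ltxx.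
have muG (j : 'I_n) : mu j.+1 < mu n.+1 by apply: mu_lt; rewrite ?ltnS.
have [|Hp Hpi] := Hpsi n.+1; first by rewrite leqnn.
exact: (trace_ge cq m0 bq Hu mu_inj muG Hp Hpi Df ipf).
Qed.

(** Every classical eigenvalue occurs in the list, and mu 1 < ... < mu n are
    classical; being sorted, the list has its k-th term at most mu k. *)
Lemma sum_eigenvalues_le q qc (lam : nat -> R) n (f df : 'I_n -> R -> R) :
  continuous qc -> (exists M, forall x, `|qc x| <= M) ->
  (forall x, 0 <= x <= pi -> q x = qc x) -> dirichlet_eigenvalues q lam ->
  (forall k, dirichlet_C1 (f k) (df k)) ->
  (forall k l, ip (f k) (f l) = (k == l)%:R) ->
  \sum_(k < n) lam k.+1 <= \sum_k energy qc (f k) (df k) (f k) (df k).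
Proof.
move=> cq bq qE Hlam Df ipf; have [mu [Hu muS tr]] := low_eigenvalues n cq bq.
apply: le_trans (tr f df Df ipf); apply: ler_sum => k _.
have lam_le i j : (0 < i)%N -> (i <= j)%N -> lam i <= lam j.
  move=> i0 /subnK <-; elim: (j - i)%N => [|d IH]; first by rewrite add0n.
  apply: le_trans IH _; rewrite addSn; apply: Hlam.1.
  by rewrite addn_gt0 i0 orbT.
suff [i ki ->] : exists2 i, (k.+1 <= i)%N & mu k.+1 = lam i by exact: lam_le.
have : (k.+1 <= n)%N by [].
elim: (nat_of_ord k) => [|j IH] jn.
  have [|u [du E]] := Hu 1%N; first by rewrite jn.
  by have [i i0 ie] := eigenvalue_listed cq qE Hlam E; exists i.
have [i ij ie] := IH (ltnW jn).
have [|u [du E]] := Hu j.+2; first by rewrite jn.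
have [l l0 le] := eigenvalue_listed cq qE Hlam E; exists l => //.
rewrite ltnNge; apply/negP => lj.
have : mu j.+1 < mu j.+2 by apply: muS; rewrite /= jn.
by rewrite -le ie ltNge lam_le// (leq_trans lj).
Qed.

End LowEigenvalues.

Section Sines.
Variable R : realType.
Implicit Types (j k n : nat) (x : R) (w : R -> R).

Lemma cont_cosk k : continuous (fun x : R => cos (k%:R * x)).
Proof.
apply: cont_comp; last exact: continuous_cos.
by apply: contM; [exact: contC|exact: cont_id].
Qed.

Lemma cont_sink k : continuous (fun x : R => sin (k%:R * x)).
Proof.
apply: cont_comp; last exact: continuous_sin.
by apply: contM; [exact: contC|exact: cont_id].
Qed.

Lemma deriv_sink k x :
  is_derive x 1 (fun x : R => sin (k%:R * x)) (k%:R * cos (k%:R * x)).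
Proof.
have h := deriv_comp (derivZ k%:R (deriv_id x)) (is_derive_sin _).
by apply: is_derive_eq h _; rewrite mulr1 mulrC.
Qed.

Lemma integ_cosk k : integ (fun x : R => cos (k%:R * x)) = (k == 0)%:R * pi.
Proof.
case: k => [|k].
  rewrite mul1r -[RHS](mul1r pi) -integ_cst; apply: integ_ext => x _.
  by rewrite mul0r cos0.
rewrite mul0r; have k0 : k.+1%:R != 0 :> R by rewrite pnatr_eq0.
have h x (_ : 0 <= x <= pi) : is_derive x 1
    (fun x : R => k.+1%:R^-1 * sin (k.+1%:R * x)) (cos (k.+1%:R * x)).
  apply: is_derive_eq (derivZ k.+1%:R^-1 (deriv_sink k.+1 x)) _.
  by rewrite mulKf.
rewrite (integ_deriv (@cont_cosk k.+1) h).
by rewrite sin_natpi !mulr0 sin0 mulr0 subrr.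
Qed.

Lemma sin_sin j k x : (k <= j)%N -> sin (j%:R * x) * sin (k%:R * x) =
  (cos ((j - k)%:R * x) - cos ((j + k)%:R * x)) / 2.
Proof.
move=> kj; rewrite natrB// natrD [(_ - _) * x]mulrBl [(_ + _) * x]mulrDl cosB cosD.
set a := cos _; set b := cos _; lra.
Qed.

Lemma cos_cos j k x : (k <= j)%N -> cos (j%:R * x) * cos (k%:R * x) =
  (cos ((j - k)%:R * x) + cos ((j + k)%:R * x)) / 2.
Proof.
move=> kj; rewrite natrB// natrD [(_ - _) * x]mulrBl [(_ + _) * x]mulrDl cosB cosD.
set a := sin _; set b := sin _; lra.
Qed.

Definition nsin k x := Num.sqrt (2 / pi) * sin (k%:R * x).
Definition dnsin k x := Num.sqrt (2 / pi) * (k%:R * cos (k%:R * x)).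

Let normE : Num.sqrt (2 / pi) * Num.sqrt (2 / pi) = 2 / pi :> R.
Proof. by rewrite -expr2 sqr_sqrtr// divr_ge0// pi_ge0. Qed.

Lemma nsin_C1 k : dirichlet_C1 (nsin k) (dnsin k).
Proof.
split.
- by apply: contM; [exact: contC|exact: cont_sink].
- apply: contM; first exact: contC.
  by apply: contM; [exact: contC|exact: cont_cosk].
- by move=> x _; exact: (derivZ _ (deriv_sink k x)).
- by rewrite /nsin mulr0 sin0 mulr0.
- by rewrite /nsin sin_natpi mulr0.
Qed.

(** Products of sines or cosines are turned into sums, so that only cosine
    coefficients of w remain. *)
Lemma form_nsin a w j k : continuous w -> (k <= j)%N ->
  form a w (nsin j) (dnsin j) (nsin k) (dnsin k) =
  a * (j%:R * k%:R) * (((j - k)%N == 0)%:R + ((j + k)%N == 0)%:R) +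
  (integ (fun x => w x * cos ((j - k)%:R * x)) -
   integ (fun x => w x * cos ((j + k)%:R * x))) / pi.
Proof.
move=> cw kj; have pi0 : pi != 0 :> R by rewrite gt_eqF ?pi_gt0.
have cwc i : continuous (fun x => w x * cos (i%:R * x)).
  by apply: contM => //; exact: cont_cosk.
pose A := a * (j%:R * k%:R) / pi.
transitivity (integ (fun x => A * (cos ((j - k)%:R * x) + cos ((j + k)%:R * x)) +
    pi^-1 * (w x * cos ((j - k)%:R * x) - w x * cos ((j + k)%:R * x)))).
  apply: integ_ext => x _; rewrite /nsin /dnsin.
  have -> : Num.sqrt (2 / pi) * (j%:R * cos (j%:R * x)) *
     (Num.sqrt (2 / pi) * (k%:R * cos (k%:R * x))) =
     Num.sqrt (2 / pi) * Num.sqrt (2 / pi) *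
       (j%:R * k%:R * (cos (j%:R * x) * cos (k%:R * x))) by ring.
  have -> : Num.sqrt (2 / pi) * sin (j%:R * x) *
     (Num.sqrt (2 / pi) * sin (k%:R * x)) =
     Num.sqrt (2 / pi) * Num.sqrt (2 / pi) *
       (sin (j%:R * x) * sin (k%:R * x)) by ring.
  by rewrite normE cos_cos// sin_sin// /A; move: (pi) pi0 => p p0; field.
have ccc : continuous (fun x : R => cos ((j - k)%:R * x) + cos ((j + k)%:R * x)).
  by apply: contD; exact: cont_cosk.
have cwcc : continuous
    (fun x => w x * cos ((j - k)%:R * x) - w x * cos ((j + k)%:R * x)).
  exact: contB.
rewrite integD; [|by apply: contM => //; exact: contC..].
rewrite !integZ// integD ?integB//; [|exact: cont_cosk..].
by rewrite !integ_cosk /A; move: (pi) pi0 => p p0; field.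
Qed.

Lemma ip_nsin j k : (0 < j)%N -> (0 < k)%N -> ip (nsin j) (nsin k) = (j == k)%:R.
Proof.
wlog kj : j k / (k <= j)%N => [H|] j0 k0.
  have [/H->//|/ltnW/H] := leqP k j; by rewrite ipC eq_sym => ->.
rewrite (ip_form _ (dnsin j) _ (dnsin k)) form_nsin//; last exact: contC.
have e i : integ (fun x : R => 1 * cos (i%:R * x)) = (i == 0)%:R * pi.
  by rewrite -integ_cosk; apply: integ_ext => x _; rewrite mul1r.
rewrite !e !mul0r add0r addn_eq0 (gtn_eqF j0)/= mul0r subr0.
rewrite mulfK ?(gt_eqF (pi_gt0 R))// subn_eq0.
by congr (_%:R); rewrite eqn_leq kj andbT.
Qed.

Lemma form_lin a w (al be : R) f df g dg h dh : continuous w ->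
  dirichlet_C1 f df -> dirichlet_C1 g dg -> dirichlet_C1 h dh ->
  form a w (fun x => al * f x + be * g x) (fun x => al * df x + be * dg x) h dh =
  al * form a w f df h dh + be * form a w g dg h dh.
Proof.
move=> cw [cf cdf _ _ _] [cg cdg _ _ _] [ch cdh _ _ _].
have c1 := @cont_form R a _ _ _ _ _ cw cf cdf ch cdh.
have c2 := @cont_form R a _ _ _ _ _ cw cg cdg ch cdh.
rewrite /form -!integZ// -integD; [|by apply: contM => //; exact: contC..].
by apply: integ_ext => x _; ring.
Qed.

Lemma dirichlet_C1_lin (al be : R) f df g dg :
  dirichlet_C1 f df -> dirichlet_C1 g dg ->
  dirichlet_C1 (fun x => al * f x + be * g x) (fun x => al * df x + be * dg x).
Proof.
move=> [cf cdf fd f0 fpi] [cg cdg gd g0 gpi]; split.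
- by apply: contD; apply: contM => //; exact: contC.
- by apply: contD; apply: contM => //; exact: contC.
- by move=> x xpi; exact: (derivD (derivZ al (fd x xpi)) (derivZ be (gd x xpi))).
- by rewrite f0 g0 !mulr0 addr0.
- by rewrite fpi gpi !mulr0 addr0.
Qed.

End Sines.

(** * The potential and the theorem *)

Section CosineExpansion.
Variables (R : realType) (q : R -> R).
Hypothesis hq : abs_cvg_cosine_expansion q.
Local Notation a k := (fourier_cos q k).

Definition cosine_sum n x : R :=
  a 0%N / 2 + \sum_(1 <= k < n.+1) a k * cos (k%:R * x).

Lemma cosine_sum_cvg x : 0 <= x <= pi -> cosine_sum ^~ x @ \oo --> q x.
Proof. by move=> xI; apply: hq.2; rewrite in_itv. Qed.

(** The tails e n of the series of |q_k| bound the uniform error of the partial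
    sums as well as the later coefficients. *)
Lemma coef_tails : exists e : nat -> R,
  [/\ forall eps, 0 < eps -> exists n, e n < eps,
      forall n m x, (n <= m)%N -> `|cosine_sum m x - cosine_sum n x| <= e n &
      forall n m, (n < m)%N -> `|a m| <= e n].
Proof.
have [cA _] := hq; pose A n := \sum_(1 <= k < n.+1) `|a k|.
have AS n : A n.+1 = A n + `|a n.+1| by rewrite /A big_nat_recr.
have Amono n m : (n <= m)%N -> A n <= A m.
  move=> /subnK <-; elim: (m - n)%N => [|d IH]; first by rewrite add0n.
  by rewrite addSn AS (le_trans IH)// lerDl.
pose l := limn A.
have Al n : A n <= l.
  apply: limr_ge => //; exists n => // m /=; exact: Amono.
exists (fun n => l - A n); split.
- move=> eps eps0; have /cvgrPdist_lt/(_ _ eps0)[n _ hn] : A @ \oo --> l by [].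
  by exists n; apply: le_lt_trans (ler_norm _) (hn n (leqnn n)).
- move=> n m x nm; apply: (@le_trans _ _ (A m - A n)); last by rewrite lerD2r.
  move: nm => /subnK <-; elim: (m - n)%N => [|d IH].
    by rewrite add0n !subrr normr0.
  rewrite addSn AS {1}/cosine_sum big_nat_recr//= addrA -/(cosine_sum _ _).
  rewrite addrAC [leRHS]addrAC; apply: le_trans (ler_normD _ _) _; apply: lerD => //.
  by rewrite normrM ler_piMr// cos_max.
- move=> n m nm; rewrite lerBrDr; apply: le_trans (Al m).
  by case: m nm => // m nm; rewrite AS addrC lerD2r Amono.
Qed.

Lemma cosine_continuous_extension : exists qc : R -> R,
  [/\ continuous qc, exists M, forall x, `|qc x| <= M,
      forall x, 0 <= x <= pi -> q x = qc x &
      forall x, cosine_sum ^~ x @ \oo --> qc x].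
Proof.
have [e [e0 He _]] := coef_tails.
have [qc [h1 h2 h3]] := uniform_limit e0 He.
exists qc; split=> //.
- apply: h3 => n; rewrite /cosine_sum; apply: contD; first exact: contC.
  have -> : (fun x : R => \sum_(1 <= k < n.+1) a k * cos (k%:R * x)) =
    (fun x => \sum_(k < n) a k.+1 * cos (k.+1%:R * x)).
    by apply/funext => x; rewrite big_add1 big_mkord.
  by apply: cont_sum => k; apply: contM; [exact: contC|exact: cont_cosk].
- exists (`|a 0%N / 2| + e 0%N) => x; have := h1 0%N x.
  rewrite /cosine_sum big_geq// addr0 => h.
  have -> : qc x = a 0%N / 2 + (qc x - a 0%N / 2) by ring.
  by apply: le_trans (ler_normD _ _) _; rewrite lerD2l.
- move=> x xI; exact: (cvg_unique _ (cosine_sum_cvg xI) (h2 x)).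
Qed.

Lemma integ_fourier qc k : (forall x, 0 <= x <= pi -> q x = qc x) ->
  integ (fun x => qc x * cos (k%:R * x)) = pi / 2 * a k.
Proof.
move=> qE; have -> : integ (fun x => qc x * cos (k%:R * x)) =
    \int[@lebesgue_measure R]_(x in `[0, pi]) (q x * cos (k%:R * x)).
  by apply: integ_ext => x /qE ->.
rewrite /fourier_cos; have pi0 : pi != 0 :> R by rewrite gt_eqF ?pi_gt0.
by set I := Rintegral _ _ _; clearbody I; move: (pi) pi0 => p p0; field.
Qed.

Lemma energy_nsin qc j k : continuous qc -> (forall x, 0 <= x <= pi -> q x = qc x) ->
  (0 < k <= j)%N -> energy qc (nsin j) (dnsin j) (nsin k) (dnsin k) =
  j%:R * k%:R * (j == k)%:R + (a (j - k)%N - a (j + k)%N) / 2.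
Proof.
move=> cq qE /andP[k0 kj]; rewrite /energy form_nsin// !(integ_fourier _ qE) mul1r.
rewrite addn_eq0 [k == 0%N]gtn_eqF// andbF addr0 subn_eq0.
have -> : (j <= k)%N = (j == k) by rewrite eqn_leq kj andbT.
have pi0 : pi != 0 :> R by rewrite gt_eqF ?pi_gt0.
by congr (_ + _); move: (pi) pi0 => p p0; field.
Qed.

Lemma energy_nsin_diag qc k : continuous qc ->
  (forall x, 0 <= x <= pi -> q x = qc x) -> (0 < k)%N ->
  energy qc (nsin k) (dnsin k) (nsin k) (dnsin k) =
  k%:R ^+ 2 + a 0%N / 2 - a (2 * k)%N / 2.
Proof.
move=> cq qE k0; rewrite (energy_nsin cq qE) ?k0 ?leqnn// eqxx mulr1 subnn addnn mul2n.
by rewrite -expr2; ring.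
Qed.

(** A periodic sequence tending to 0 vanishes. *)
Lemma coef_periodic_eq0 n : (0 < n)%N ->
  (forall d, (0 < d)%N -> a d = a (d + n)%N) -> forall d, (0 < d)%N -> a d = 0.
Proof.
move=> n0 per d d0; have [e [e0 _ He]] := coef_tails.
have aE i : a d = a (d + i * n)%N.
  elim: i => [|i IH]; first by rewrite mul0n addn0.
  by rewrite IH per ?addn_gt0 ?d0// mulSn -addnA [(n + _)%N]addnC.
apply/eqP; rewrite -normr_le0; apply/ler_addgt0Pr => eps /e0[N eN].
rewrite add0r (aE N.+1); apply: le_trans (ltW eN); apply: He.
apply: (leq_trans _ (leq_addl _ _)); exact: leq_pmulr.
Qed.

Lemma cos_natpi k : cos (k%:R * pi) = (-1) ^+ k :> R.
Proof.
by rewrite mulr_natl -[_ *+ _]add0r (alternatingn (@cosDpi R)) cos0 mulr1.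
Qed.

(** cos (k 0) + cos (k pi) is 2 for even k and 0 for odd k, so the partial sums of
    the expansions of q 0 and q pi add up to the even coefficients. *)
Lemma even_coefs_cvg :
  (fun n : nat => - (1 / 2) * \sum_(1 <= k < n.+1) a (2 * k)%N) @ \oo -->
      1 / (2 * pi) * (\int[@lebesgue_measure R]_(x in `[0, pi]) q x)%R
        - (q 0 + q pi) / 4.
Proof.
have sumE n : - (1 / 2) * \sum_(1 <= k < n.+1) a (2 * k)%N =
    a 0%N / 4 - (cosine_sum (2 * n) 0 + cosine_sum (2 * n) pi) / 4.
  suff : \sum_(1 <= k < (2 * n).+1) a k * cos (k%:R * 0) +
      \sum_(1 <= k < (2 * n).+1) a k * cos (k%:R * pi) =
      2 * \sum_(1 <= k < n.+1) a (2 * k)%N by rewrite /cosine_sum => h; lra.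
  elim: n => [|n IH]; first by rewrite !big_geq// mulr0 addr0.
  have recr (F : nat -> R) m :
      \sum_(1 <= k < m.+2) F k = \sum_(1 <= k < m.+1) F k + F m.+1.
    by rewrite big_nat_recr.
  have e2 : (2 * n.+1 = (2 * n).+2)%N by rewrite mulnS add2n.
  rewrite {1 2}e2 !recr [2 * (_ + _)]mulrDr -IH !mulr0 !cos0 !cos_natpi e2.
  by rewrite !exprS exprM sqrrN !expr1n; ring.
have aE : 1 / (2 * pi) * (\int[@lebesgue_measure R]_(x in `[0, pi]) q x)%R = a 0%N / 4.
  rewrite /fourier_cos.
  have -> : \int[@lebesgue_measure R]_(x in `[0, pi]) (q x * cos (0%:R * x)) =
      \int[@lebesgue_measure R]_(x in `[0, pi]) q x.
    by apply: eq_Rintegral => x _; rewrite mul0r cos0 mulr1.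
  have pi0 : pi != 0 :> R by rewrite gt_eqF ?pi_gt0.
  by set I := Rintegral _ _ _; clearbody I; move: (pi) pi0 => p p0; field.
rewrite aE; under eq_fun do rewrite sumE.
have n2 : (fun n : nat => 2 * n)%N @ \oo --> \oo.
  move=> P [N _ HN]; exists N => // n /= Nn; apply: HN.
  by rewrite /= (leq_trans Nn)// leq_pmull.
have pI : 0 <= pi :> R := pi_ge0 R.
apply: cvgB; first exact: cvg_cst.
apply: cvgM; last exact: cvg_cst.
have h0 : 0 <= (0 : R) <= pi by rewrite lexx.
have hpi : 0 <= (pi : R) <= pi by rewrite lexx pI.
apply: cvgD; first exact: (cvg_comp _ _ n2 (cosine_sum_cvg h0)).
exact: (cvg_comp _ _ n2 (cosine_sum_cvg hpi)).
Qed.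

End CosineExpansion.

(** First order condition at a minimum: A, B, C are the matrix elements of a
    quadratic form on the span of f and g, minimal at f among the unit vectors
    (f + t g) / sqrt (1 + t ^ 2). *)
Lemma critical_cross_term (R : realType) (A B C : R) :
  (forall t, 0 <= 2 * t * B + t ^+ 2 * (C - A)) -> B = 0.
Proof.
move=> H; apply/eqP; rewrite -sqrf_eq0; apply/negPn/negP => B0.
have B2 : 0 < B ^+ 2 by rewrite lt_neqAle eq_sym B0 sqr_ge0.
pose s := (`|C - A| + 1)^-1.
have d0 : 0 < `|C - A| + 1 by rewrite ltr_wpDl.
have s0 : 0 < s by rewrite invr_gt0.
have sd : s * (`|C - A| + 1) = 1 by rewrite mulVf// gt_eqF.
have h1 : s * (C - A) <= 1.
  rewrite -sd ler_wpM2l ?(ltW s0)//; apply: le_trans (ler_norm _) _.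
  by rewrite lerDl.
have := H (- (s * B)).
have -> : 2 * - (s * B) * B + (- (s * B)) ^+ 2 * (C - A) =
  s * B ^+ 2 * (s * (C - A) - 2) by ring.
have sB : 0 < s * B ^+ 2 by apply: mulr_gt0.
by rewrite (pmulr_rge0 _ sB) subr_ge0 => /le_trans/(_ h1); lra.
Qed.

Section Main.
Variables (R : realType) (q : R -> R) (lam : nat -> R).
Hypotheses (hq : abs_cvg_cosine_expansion q) (hlam : dirichlet_eigenvalues q lam).
Local Notation a k := (fourier_cos q k).

Let sum_ord n (F : nat -> R) : \sum_(1 <= k < n.+1) F k = \sum_(k < n) F k.+1.
Proof. by rewrite big_add1 big_mkord. Qed.

Lemma partial_sum_le n :
  \sum_(1 <= k < n.+1) (lam k - k%:R ^+ 2 - a 0%N / 2) <=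
  - (1 / 2) * \sum_(1 <= k < n.+1) a (2 * k)%N.
Proof.
have [qc [cq bq qE _]] := cosine_continuous_extension hq.
have := sum_eigenvalues_le (n := n) cq bq qE hlam
  (fun k => nsin_C1 R k.+1) (fun k l => ip_nsin R (ltn0Sn k) (ltn0Sn l)).
rewrite -subr_ge0 -sumrB => h; rewrite !sum_ord mulr_sumr -subr_ge0 -sumrB.
move: h; congr (0 <= _); apply: eq_bigr => k _.
by rewrite (energy_nsin_diag cq qE)//; ring.
Qed.

(** In case of equality the span of the first n sines is optimal, so rotating
    the last one towards the (n + d)-th cannot lower the trace; the matrix
    element between the two vanishes. *)
Lemma equality_coef n d : (0 < d)%N ->
  \sum_(1 <= k < n.+2) (lam k - k%:R ^+ 2 - a 0%N / 2) =
  - (1 / 2) * \sum_(1 <= k < n.+2) a (2 * k)%N ->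
  a d = a (d + 2 * n.+1)%N.
Proof.
move=> d0 eq; have [qc [cq bq qE _]] := cosine_continuous_extension hq.
pose E j k := energy qc (nsin j) (dnsin j) (nsin k) (dnsin k).
have lamE : \sum_(k < n.+1) lam k.+1 = \sum_(k < n.+1) E k.+1 k.+1.
  move: eq; rewrite !sum_ord mulr_sumr => /eqP; rewrite -subr_eq0 -sumrB => /eqP eq.
  apply/eqP; rewrite -subr_eq0 -sumrB; apply/eqP.
  rewrite -[RHS]eq; apply: eq_bigr => k _.
  by rewrite /E (energy_nsin_diag cq qE)//; ring.
pose N := n.+1; pose j := (d + n.+1)%N.
have jN : (j == N) = false by rewrite /j /N -{2}[n.+1]add0n eqn_add2r gtn_eqF.
suff /critical_cross_term : forall t, 0 <= 2 * t * E j N + t ^+ 2 * (E j j - E N N).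
  rewrite /E (energy_nsin cq qE)//; last by rewrite leq_addl.
  rewrite jN mulr0 add0r /j /N addnK => /eqP; rewrite mulf_eq0 invr_eq0.
  rewrite (_ : (2 : R) == 0 = false) ?orbF ?subr_eq0 ?pnatr_eq0// => /eqP->.
  by rewrite -addnA addnn mul2n.
move=> t; pose al := (Num.sqrt (1 + t ^+ 2))^-1; pose be := t * al.
have p0 : 0 < 1 + t ^+ 2 by rewrite ltr_wpDr// sqr_ge0.
have al2 : al ^+ 2 = (1 + t ^+ 2)^-1 by rewrite /al exprVn sqr_sqrtr// ltW.
have unit_ab : al ^+ 2 + be ^+ 2 = 1.
  by rewrite /be exprMn al2; field; rewrite gt_eqF.
pose g x := al * nsin N x + be * nsin j x.
pose dg x := al * dnsin N x + be * dnsin j x.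
have DN := nsin_C1 R N; have Dj := nsin_C1 R j.
have Dg : dirichlet_C1 g dg by exact: dirichlet_C1_lin.
have c1 : continuous (fun _ : R => 1 : R) by exact: contC.
have ipg h dh : dirichlet_C1 h dh ->
    ip g h = al * ip (nsin N) h + be * ip (nsin j) h.
  move=> Dh; rewrite (ip_form _ dg _ dh) (form_lin _ _ _ c1 DN Dj Dh).
  by rewrite -!ip_form.
have ipgk k : (k < n)%N -> ip g (nsin k.+1) = 0.
  move=> kn; rewrite (ipg _ _ (nsin_C1 R k.+1)) !ip_nsin// /N /j ?addn_gt0 ?d0//.
  rewrite eqSS (gtn_eqF kn) mulr0 add0r gtn_eqF ?mulr0//.
  by rewrite addnS ltnS (leq_trans kn)// leq_addl.
have jpos : (0 < j)%N by rewrite addn_gt0 d0.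
have ipgg : ip g g = 1.
  rewrite (ipg _ _ Dg) ![ip (nsin _) g]ipC (ipg _ _ DN) (ipg _ _ Dj).
  rewrite !ip_nsin// !eqxx jN [N == j]eq_sym jN -[RHS]unit_ab /=; ring.
pose f (k : 'I_n.+1) := if (k < n)%N then nsin k.+1 else g.
pose df (k : 'I_n.+1) := if (k < n)%N then dnsin k.+1 else dg.
have Df k : dirichlet_C1 (f k) (df k).
  by rewrite /f /df; case: ifP => _ //; exact: nsin_C1.
have ipf k l : ip (f k) (f l) = (k == l)%:R.
  rewrite /f; case: ltnP => kn; case: ltnP => ln.
  - by rewrite ip_nsin// eqSS.
  - rewrite ipC ipgk//; case: eqP => // kl.
    by move: kn; rewrite kl ltnNge ln.
  - rewrite ipgk//; case: eqP => // kl.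
    by move: ln; rewrite -kl ltnNge kn.
  - rewrite ipgg; case: eqP => // -[]; apply/val_inj => /=.
    by apply/eqP; rewrite eqn_leq (leq_trans _ ln) 1?(leq_trans _ kn)// -ltnS.
have := sum_eigenvalues_le cq bq qE hlam Df ipf.
rewrite lamE !big_ord_recr/= /f /df ltnn.
have -> : \sum_(i < n) energy qc
    (if (i < n)%N then nsin i.+1 else g) (if (i < n)%N then dnsin i.+1 else dg)
    (if (i < n)%N then nsin i.+1 else g) (if (i < n)%N then dnsin i.+1 else dg) =
    \sum_(i < n) E i.+1 i.+1 by apply: eq_bigr => i _; rewrite ltn_ord.
rewrite lerD2l.
have -> : energy qc g dg g dg = al ^+ 2 * E N N + 2 * al * be * E j N + be ^+ 2 * E j j.
  rewrite /energy (form_lin _ _ _ cq DN Dj Dg) ![form _ _ (nsin _) _ g _]formC.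
  rewrite !(form_lin _ _ _ cq DN Dj) // [form 1 qc (nsin N) _ (nsin j) _]formC.
  by rewrite /E /energy; ring.
rewrite -/N /be exprMn al2 -subr_ge0.
have -> : (1 + t ^+ 2)^-1 * E N N + 2 * al * (t * al) * E j N +
   t ^+ 2 * (1 + t ^+ 2)^-1 * E j j - E N N =
   (1 + t ^+ 2)^-1 * (2 * t * E j N + t ^+ 2 * (E j j - E N N)).
  have -> : 2 * al * (t * al) * E j N = 2 * t * al ^+ 2 * E j N by ring.
  by rewrite al2; field; rewrite gt_eqF.
by rewrite pmulr_rge0 ?invr_gt0.
Qed.

Lemma equality_constant n : (0 < n)%N ->
  \sum_(1 <= k < n.+1) (lam k - k%:R ^+ 2 - a 0%N / 2) =
  - (1 / 2) * \sum_(1 <= k < n.+1) a (2 * k)%N ->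
  exists c, forall x, x \in `[0, pi] -> q x = c.
Proof.
case: n => // n _ eq.
have a0 : forall d, (0 < d)%N -> a d = 0.
  apply: (coef_periodic_eq0 hq (n := (2 * n.+1)%N)) => // d d0.
  exact: equality_coef.
exists (a 0%N / 2) => x; rewrite in_itv/= => xI.
apply: (cvg_unique _ (cosine_sum_cvg hq xI)) => //.
have -> : cosine_sum q ^~ x = fun=> a 0%N / 2; last exact: cvg_cst.
apply/funext => k; rewrite /cosine_sum big_nat big1 ?addr0// => i /andP[i0 _].
by rewrite a0// mul0r.
Qed.

End Main.

Unset Implicit Arguments.

Theorem theorem3p1 (R : realType) (q : R -> R) (lam : nat -> R)
    (hq : abs_cvg_cosine_expansion q)
    (hlam : dirichlet_eigenvalues q lam) :
  [/\ forall n : nat, (1 <= n)%N ->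
        \sum_(1 <= k < n.+1) (lam k - (k%:R) ^+ 2 - fourier_cos q 0 / 2) <=
        - (1 / 2) * \sum_(1 <= k < n.+1) fourier_cos q (2 * k)%N,
      forall n : nat, (1 <= n)%N ->
        \sum_(1 <= k < n.+1) (lam k - (k%:R) ^+ 2 - fourier_cos q 0 / 2) =
        - (1 / 2) * \sum_(1 <= k < n.+1) fourier_cos q (2 * k)%N ->
        exists c : R, forall x : R, x \in `[0, pi] -> q x = c
    & (fun n : nat =>
         - (1 / 2) * \sum_(1 <= k < n.+1) fourier_cos q (2 * k)%N) @ \oo -->
      1 / (2 * pi) * (\int[@lebesgue_measure R]_(x in `[0, pi]) q x)%R
        - (q 0 + q pi) / 4].
Proof.
split=> [n _|n n0|]; [exact: partial_sum_le|exact: equality_constant|].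
exact: even_coefs_cvg.
Qed.
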